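(* Let $R$ be a valuation ring with maximal ideal $P$, and assume that $Z\neq 0$, where $Z$ is the set of zero-divisors of $R$. Then the following conditions are equivalent: (1) $R$ is strongly coherent; (2) $R$ is $\pi$-coherent; (3) $R^R$ (the product of copies of $R$ indexed by the set $R$) is singly projective and separable; (4) $C^*=\mathrm{Hom}_R(C,R)$ is a finitely generated module for each finitely generated $R$-module $C$; (5) the annihilator $(0:A)$ is finitely generated for each proper ideal $A$ of $R$, and $R$ is self injective (i.e. injective as an $R$-module); (6) $R$ is maximal, $P$ is principal or faithful, and for each ideal $A$ of $R$ there exists $a\in R$ such that either $A=Ra$ or $A=Pa$; (7) each ideal of $R$ is countably generated and $R^{\mathbb{N}}$ is singly projective and separable; (8) $R^R$ is a separable flat content module; (9) each ideal of $R$ is countably generated and $R^{\mathbb{N}}$ is a separable flat content module; (10) each product of separable flat content $R$-modules is a separable flat content module; (11) $R$ is maximal, $P$ is principal or faithful, and the intersection of any non-empty family of principal ideals of $R$ is finitely generated.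
   Context: A valuation ring is a commutative ring $R$ (possibly with zero-divisors) whose set of ideals is totally ordered by inclusion. $Z=\{s\in R\mid \exists\, 0\ne x\in R,\ sx=0\}$, so $Z\ne 0$ means that $R$ is not a domain. An ideal is faithful if its annihilator is $0$. $R$ is maximal if every family of cosets $\{a_i+L_i\mid i\in I\}$ ($a_i\in R$, $L_i$ ideals of $R$, $I$ an arbitrary index set) with the finite intersection property has a non-empty intersection. An $R$-module $M$ is singly projective if, for any cyclic submodule $N$ of $M$, the inclusion map $N\to M$ factors through a free module. $M$ is locally projective if, for any finitely generated submodule $N$ of $M$, there exist a free module $F$ and homomorphisms $\phi:M\to F$ and $\pi:F\to M$ such that $\pi(\phi(x))=x$ for all $x\in N$. A commutative ring $R$ is strongly coherent if each product of locally projective $R$-modules is locally projective, and $\pi$-coherent if, for each index set $\Lambda$, every finitely generated submodule of $R^{\Lambda}$ is finitely presented. A module is uniserial if its set of submodules is totally ordered by inclusion; $M$ is separable if any finite subset of $M$ is contained in a direct summand of $M$ which is a finite direct sum of uniserial submodules. For $x\in M$, the content ideal $\mathrm{c}(x)$ is the intersection of all ideals $A$ of $R$ for which $x\in AM$; $M$ is a content module if $x\in\mathrm{c}(x)M$ for all $x\in M$; a flat content module is a module that is both flat and content. *)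

(* Defs.v *)
From HB Require Import structures.
From mathcomp Require Import all_boot all_order all_algebra.
From mathcomp Require Import sesquilinear generic_quotient.
From mathcomp Require Import boolp classical_sets functions cardinality.

Set Implicit Arguments.
Unset Strict Implicit.
Unset Printing Implicit Defensive.

Import GRing.Theory.

Local Open Scope quotient_scope.
Local Open Scope classical_set_scope.
Local Open Scope ring_scope.

Section Submodules.
Variables (R : comNzRingType) (M : lmodType R).

Definition is_submodule (A : set M) :=
  A 0 /\ forall (a : R) (x y : M), A x -> A y -> A (a *: x + y).

Record submodule := Submodule {
  submodule_set :> set M;
  submoduleP : is_submodule submodule_set }.

Definition generated (X : set M) : set M := smallest is_submodule X.

Definition fin_gen (A : set M) :=
  exists2 X : set M, finite_set X & A = generated X.

Definition countably_gen (A : set M) :=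
  exists2 X : set M, countable X & A = generated X.

Definition is_cyclic (A : set M) := exists x : M, A = generated [set x].

Definition uniserial :=
  forall A B : submodule, A `<=` B \/ B `<=` A.

Definition direct_summand (D : submodule) := exists E : submodule,
  D `&` E = [set 0] /\ [set d + e | d in D & e in E] = setT.

Definition direct_sum_of (D : submodule) n (U : 'I_n -> submodule) :=
  let V := [set u : 'I_n -> M | forall i, (U i : set M) (u i)] in
  [set \sum_i u i | u in V] = D /\
  forall u : 'I_n -> M, V u -> \sum_i u i = 0 -> forall i, u i = 0.

End Submodules.

Arguments uniserial {R} M.

Notation ideal R := (submodule R^o).

Section SubmoduleType.
Variables (R : comNzRingType) (M : lmodType R) (A : submodule M).

Definition submod : Type := {x : M | x \in (A : set M)}.

HB.instance Definition _ := SubChoice.on submod.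

Lemma submod_subproof : subsemimod_closed (mem (A : set M)).
Proof.
have [A0 AZD] := submoduleP A; have AZ a x : (A : set M) x -> (A : set M) (a *: x).
  by move=> Ax; rewrite -[_ *: _]addr0; exact: AZD.
split; [split|].
- exact: mem_set.
- move=> x y /set_mem Ax /set_mem Ay; apply: mem_set.
  by rewrite -[x]scale1r; exact: AZD.
- by move=> a x /set_mem Ax; apply: mem_set; exact: AZ.
Qed.

HB.instance Definition _ :=
  GRing.SubChoice_isSubLmodule.Build R M _ submod submod_subproof.

End SubmoduleType.

(* The library only has the lmodType structure on non-dependent functions. *)
Section Product.
Variables (R : comNzRingType) (I : Type) (M : I -> lmodType R).

Definition module_product : Type := forall i, M i.

HB.instance Definition _ := Choice.on module_product.

Implicit Types f g h : module_product.

Let add f g : module_product := fun i => f i + g i.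
Let opp f : module_product := fun i => - f i.
Let zero : module_product := fun=> 0.
Let scale (a : R) f : module_product := fun i => a *: f i.

Let addA : associative add.
Proof. by move=> f g h; apply: functional_extensionality_dep => i; exact: addrA. Qed.
Let addC : commutative add.
Proof. by move=> f g; apply: functional_extensionality_dep => i; exact: addrC. Qed.
Let add0 : left_id zero add.
Proof. by move=> f; apply: functional_extensionality_dep => i; exact: add0r. Qed.
Let addN : left_inverse zero opp add.
Proof. by move=> f; apply: functional_extensionality_dep => i; exact: addNr. Qed.

HB.instance Definition _ :=
  GRing.isZmodule.Build module_product addA addC add0 addN.

Let scaleA a b f : scale a (scale b f) = scale (a * b) f.
Proof. by apply: functional_extensionality_dep => i; exact: scalerA. Qed.
Let scale1 : left_id 1 scale.
Proof. by move=> f; apply: functional_extensionality_dep => i; exact: scale1r. Qed.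
Let scaleDr : right_distributive scale +%R.
Proof.
by move=> a f g; apply: functional_extensionality_dep => i; exact: scalerDr.
Qed.
Let scaleDl f : {morph scale^~ f : a b / a + b}.
Proof.
by move=> a b; apply: functional_extensionality_dep => i; exact: scalerDl.
Qed.

HB.instance Definition _ :=
  GRing.Zmodule_isLmodule.Build R module_product scaleA scale1 scaleDr scaleDl.

End Product.

Definition module_power (R : comNzRingType) (I : Type) : lmodType R :=
  module_product (fun _ : I => R^o : lmodType R).

Section Modules.
Variable R : comNzRingType.
Implicit Types M N F : lmodType R.

Definition is_basis F (B : set F) :=
  generated B = setT /\
  forall (s : seq F) (a : F -> R), uniq s -> (forall x, x \in s -> B x) ->
    \sum_(x <- s) a x *: x = 0 -> forall x, x \in s -> a x = 0.

Definition free_module F := exists B : set F, is_basis B.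

Definition singly_projective M :=
  forall N : submodule M, is_cyclic N ->
  exists (F : lmodType R) (u : {linear submod N -> F}) (v : {linear F -> M}),
    free_module F /\ forall x : submod N, v (u x) = val x.

Definition locally_projective M :=
  forall N : submodule M, fin_gen N ->
  exists (F : lmodType R) (phi : {linear M -> F}) (pi : {linear F -> M}),
    free_module F /\ forall x, (N : set M) x -> pi (phi x) = x.

Definition fin_presented M :=
  exists (n : nat) (f : {linear 'rV[R]_n -> M}),
    range f = setT /\ fin_gen (f @^-1` [set 0]).

Definition separable_module M :=
  forall X : set M, finite_set X -> exists D : submodule M,
  [/\ X `<=` D, direct_summand D &
      exists n (U : 'I_n -> submodule M),
        (forall i, uniserial (submod (U i))) /\ direct_sum_of D U].

Definition injective_module M :=
  forall (A B : lmodType R) (f : {linear A -> B}) (g : {linear A -> M}),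
    injective f -> exists h : {linear B -> M}, forall x, h (f x) = g x.

(* Hom_R(M, R), as a set of functions; it is a submodule of [M -> R^o]. *)
Definition dual_module M : set (M -> R^o) := [set f | linear f].

Definition ideal_mul (A : set R^o) M : set M :=
  generated [set a *: x | a in A & x in [set: M]].
Arguments ideal_mul : clear implicits.

Definition content_ideal M (x : M) : set R^o :=
  \bigcap_(A in [set A : ideal R | ideal_mul A M x]) (A : set R^o).

Definition content_module M := forall x : M, ideal_mul (content_ideal x) M x.

(* [t] exhibits [T] as the tensor product of [M] and [N]. *)
Definition is_tensor M N (T : lmodType R) (t : {bilinear M -> N -> T}) :=
  forall (W : lmodType R) (b : {bilinear M -> N -> W}),
  exists g : {linear T -> W}, (forall x y, g (t x y) = b x y) /\
    forall g' : {linear T -> W}, (forall x y, g' (t x y) = b x y) -> g' =1 g.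

(* [g] below is the map induced by [f] on the tensor products with [M];
   [tensor_exists] shows that these tensor products always exist. *)
Definition flat M :=
  forall (A B : lmodType R) (f : {linear A -> B}), injective f ->
  forall (TA TB : lmodType R)
         (tA : {bilinear M -> A -> TA}) (tB : {bilinear M -> B -> TB}),
    is_tensor tA -> is_tensor tB ->
  forall g : {linear TA -> TB},
    (forall x a, g (tA x a) = tB x (f a)) -> injective g.

Definition flat_content M := flat M /\ content_module M.

Definition sep_flat_content M := separable_module M /\ flat_content M.

End Modules.

Arguments ideal_mul {R} A M.
Arguments dual_module {R} M.

Section TensorExists.
Variables (R : comNzRingType) (M N : lmodType R).

(* Elements are formal sums of terms r *: (x (x) y), two sums being identified
   when every bilinear map takes the same value on them. *)
Let E := seq (R * M * N).

Let ev (W : lmodType R) (b : {bilinear M -> N -> W}) (s : E) : W :=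
  \sum_(p <- s) p.1.1 *: b p.1.2 p.2.

Let rel (s s' : E) : bool :=
  `[< forall (W : lmodType R) (b : {bilinear M -> N -> W}), ev b s = ev b s' >].

Let rel_refl : reflexive rel. Proof. by move=> s; apply/asboolP. Qed.
Let rel_sym : symmetric rel.
Proof. by move=> s s'; apply/asboolP/asboolP => h W b; rewrite h. Qed.
Let rel_trans : transitive rel.
Proof.
by move=> s s' s'' /asboolP h /asboolP h'; apply/asboolP => W b; rewrite h.
Qed.

Let relE : equiv_rel E := EquivRel rel rel_refl rel_sym rel_trans.

Definition tensor : Type := {eq_quot relE}.

HB.instance Definition _ := Choice.on tensor.
HB.instance Definition _ := EqQuotient.on tensor.

Let evt (W : lmodType R) (b : {bilinear M -> N -> W}) (t : tensor) : W :=
  ev b (repr t).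

Let evt_pi (W : lmodType R) (b : {bilinear M -> N -> W}) (s : E) :
  evt b (\pi_tensor s) = ev b s.
Proof.
have : \pi_tensor (repr (\pi_tensor s)) = \pi_tensor s by rewrite reprK.
by move=> /eqmodP /asboolP; exact.
Qed.

Let evt_inj (t t' : tensor) :
  (forall (W : lmodType R) (b : {bilinear M -> N -> W}), evt b t = evt b t') ->
  t = t'.
Proof.
move=> h; rewrite -(reprK t) -(reprK t'); apply/eqmodP/asboolP => W b.
exact: h.
Qed.

Let add (t t' : tensor) := \pi_tensor (repr t ++ repr t').
Let scale (a : R) (t : tensor) :=
  \pi_tensor [seq (a * p.1.1, p.1.2, p.2) | p <- repr t].
Let opp (t : tensor) := scale (-1) t.
Let zero := \pi_tensor [::].

Let evtD W b t t' : @evt W b (add t t') = evt b t + evt b t'.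
Proof. by rewrite evt_pi /ev big_cat. Qed.
Let evtZ W b a t : @evt W b (scale a t) = a *: evt b t.
Proof.
rewrite evt_pi /ev big_map scaler_sumr; apply: eq_bigr => p _ /=.
by rewrite scalerA.
Qed.
Let evt0 W b : @evt W b zero = 0.
Proof. by rewrite evt_pi /ev big_nil. Qed.
Let evtN W b t : @evt W b (opp t) = - evt b t.
Proof. by rewrite evtZ scaleN1r. Qed.

Let addA : associative add.
Proof. by move=> x y z; apply: evt_inj => W b; rewrite !evtD addrA. Qed.
Let addC : commutative add.
Proof. by move=> x y; apply: evt_inj => W b; rewrite !evtD addrC. Qed.
Let add0 : left_id zero add.
Proof. by move=> x; apply: evt_inj => W b; rewrite !evtD evt0 add0r. Qed.
Let addN : left_inverse zero opp add.
Proof. by move=> x; apply: evt_inj => W b; rewrite evtD evtN evt0 addNr. Qed.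

HB.instance Definition _ := GRing.isZmodule.Build tensor addA addC add0 addN.

Let scaleA a a' t : scale a (scale a' t) = scale (a * a') t.
Proof. by apply: evt_inj => W b; rewrite !evtZ scalerA. Qed.
Let scale1 : left_id 1 scale.
Proof. by move=> t; apply: evt_inj => W b; rewrite evtZ scale1r. Qed.
Let scaleDr : right_distributive scale +%R.
Proof.
by move=> a t t'; apply: evt_inj => W b; rewrite evtZ !evtD !evtZ scalerDr.
Qed.
Let scaleDl t : {morph scale^~ t : a a' / a + a'}.
Proof. by move=> a a'; apply: evt_inj => W b; rewrite evtD !evtZ scalerDl. Qed.

HB.instance Definition _ :=
  GRing.Zmodule_isLmodule.Build R tensor scaleA scale1 scaleDr scaleDl.

Definition tens (x : M) (y : N) : tensor := \pi_tensor [:: (1, x, y)].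

Let evt_tens W b x y : @evt W b (tens x y) = b x y.
Proof. by rewrite evt_pi /ev big_seq1 scale1r. Qed.

Lemma tens_bilinear :
  bilinear_for ( *:%R : GRing.Scale.law R tensor)
               ( *:%R : GRing.Scale.law R tensor) tens.
Proof.
split=> [y a x x'|x a y y']; apply: evt_inj => W b.
  by rewrite evtD evtZ !evt_tens linearPl.
by rewrite evtD evtZ !evt_tens linearPr.
Qed.

HB.instance Definition _ := bilinear_isBilinear.Build R M N tensor *:%R *:%R
  tens tens_bilinear.

Let evt_linear W b : linear (@evt W b).
Proof. by move=> a t t'; rewrite evtD evtZ. Qed.

Lemma tensor_exists :
  exists (T : lmodType R) (t : {bilinear M -> N -> T}), is_tensor t.
Proof.
exists tensor, tens => W b.
pose gM := GRing.isLinear.Build R tensor W *:%R (evt b) (evt_linear b).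
pose g : {linear tensor -> W} := HB.pack (evt b) gM.
exists g; split=> [x y|g' g'E t]; first exact: evt_tens.
have -> : t = \sum_(p <- repr t) p.1.1 *: tens p.1.2 p.2.
  apply: evt_inj => W' b'; rewrite {1}/evt /ev.
  elim: (repr t) => [|p s IH]; first by rewrite !big_nil evt0.
  by rewrite !big_cons evtD evtZ evt_tens IH.
rewrite !linear_sum; apply: eq_bigr => p _.
by rewrite !linearZ g'E /= evt_tens.
Qed.

End TensorExists.

Section Rings.
Variable R : comNzRingType.
Implicit Types A P : ideal R.

Definition valuation_ring := forall A B : ideal R, A `<=` B \/ B `<=` A.

Definition is_proper_ideal A := A <> setT :> set R.

Definition maximal_ideal P :=
  is_proper_ideal P /\
  forall A, is_proper_ideal A -> P `<=` A -> A = P :> set R.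

Definition zero_divisors : set R := [set s | exists2 x, x <> 0 & s * x = 0].

Definition annihilator_of (A : set R^o) : set R^o :=
  [set r : R | forall a : R, A a -> r * a = 0].

Definition faithful_ideal (A : set R^o) := annihilator_of A = [set 0].

Definition principal_ideal (a : R) : set R^o := [set r * a | r in [set: R]].

Definition is_principal_ideal (A : set R^o) := exists a : R, A = principal_ideal a.

Definition ideal_mulr (A : set R^o) (a : R) : set R^o :=
  [set p * a | p in (A : set R)].

Definition ring_coset (a : R) (A : ideal R) : set R :=
  [set a + x | x in (A : set R)].

Definition maximal_ring :=
  forall (I : Type) (a : I -> R) (L : I -> ideal R),
    (forall J : set I, finite_set J -> \bigcap_(i in J) ring_coset (a i) (L i) !=set0) ->
    \bigcap_i ring_coset (a i) (L i) !=set0.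

Definition strongly_coherent :=
  forall (I : Type) (M : I -> lmodType R),
    (forall i, locally_projective (M i)) -> locally_projective (module_product M).

Definition pi_coherent :=
  forall (I : Type) (N : submodule (module_power R I)),
    fin_gen N -> fin_presented (submod N).

Definition self_injective := injective_module (R^o : lmodType R).

End Rings.

Arguments valuation_ring : clear implicits.
Arguments zero_divisors : clear implicits.
Arguments maximal_ring : clear implicits.
Arguments strongly_coherent : clear implicits.
Arguments pi_coherent : clear implicits.
Arguments self_injective : clear implicits.

(* Main.v *)
(** All conditions are compared with (6).

    Suppose that every annihilator [(0 : S)] is principal.  As [Z <> 0], every
    element of [P] is a zero-divisor: if [s] in [P] is regular, [z w = 0] with
    [z, w <> 0] and [(0 : z) = R y], then [y = s y'] with [y'] in [R y], so
    [y = 0].  Hence [(0 : (0 : r)) = R r], intersections of principal ideals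
    are principal, every ideal is [R a] or [P a], and [P] is principal or
    faithful.  What is left of (6) is maximality.  For a chain of cosets
    [c + R t] without smallest element, [P] is not principal, and for each [q]
    in [P] the family [q c] has a limit [w_q] in [R], because [q t] lies in the
    intersection of the [R t] for some [t].  If a family [q] of generators of
    [P], seen as an element of a power [R^I], satisfies [f q = 1] for some
    [f : R^I -> R], then [f (w_q)] is a limit of the [c].  Such an [f] exists
    if [R] is self-injective, or if [R^I] is separable, since a uniserial
    summand not contained in [P R^I] is free.  In (2) and (4) one uses instead
    that the [q] for which [q c] has a limit form a finitely generated ideal,
    which contains [P] and is therefore [R].

    Conversely, under (6) the ring is self-injective by Baer's criterion, and
    a module is flat and content iff each of its elements can be written
    [f x *: y] with [f] a functional.  This property passes to products, and by
    elimination it puts any finite subset in a finite free direct summand. *)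

Require Import Defs.
From HB Require Import structures.
From mathcomp Require Import all_boot all_order all_algebra.
From mathcomp Require Import sesquilinear generic_quotient.
From mathcomp Require Import boolp classical_sets functions cardinality.
From mathcomp Require Import ring.

Import GRing.Theory.
Local Open Scope quotient_scope.
Local Open Scope classical_set_scope.
Local Open Scope ring_scope.

Set Implicit Arguments.
Unset Strict Implicit.
Unset Printing Implicit Defensive.

(** * Submodules and divisibility *)

Lemma linear_bundle (R : comNzRingType) (M N : lmodType R) (f : M -> N) :
  linear f -> exists g : {linear M -> N}, g =1 f.
Proof.
move=> lf; pose gM := GRing.isLinear.Build R M N *:%R f lf.
by pose g : {linear M -> N} := HB.pack f gM; exists g.
Qed.

Lemma bilinear_bundle (R : comNzRingType) (M N W : lmodType R)
    (f : M -> N -> W) :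
  (forall y, linear (f^~ y)) -> (forall x, linear (f x)) ->
  exists g : {bilinear M -> N -> W}, forall x y, g x y = f x y.
Proof.
move=> lf rf.
have bf : bilinear_for ( *:%R : GRing.Scale.law R W)
   ( *:%R : GRing.Scale.law R W) f by split=> y a u v; [exact: lf|exact: rf].
pose gM := bilinear_isBilinear.Build R M N W *:%R *:%R f bf.
by pose g : {bilinear M -> N -> W} := HB.pack f gM; exists g.
Qed.

Lemma finite_set_family (T : eqType) (X : set T) : finite_set X ->
  exists n (x : 'I_n -> T), X = range x.
Proof.
move=> /finite_seqP [s ->]; exists (size s), (tnth (in_tuple s)).
apply/seteqP; split=> [y /= /(tnthP (in_tuple s)) [i ->]|_ [i _ <-] /=].
  by exists i.
exact: mem_tnth.
Qed.

Lemma regularZE (R : comNzRingType) (a : R) (x : R^o) : a *: x = a * x.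
Proof. by []. Qed.

Section Submodules.
Variables (R : comNzRingType) (M : lmodType R).
Implicit Types (A : set M) (s : seq M).

Lemma submodD A x y : is_submodule A -> A x -> A y -> A (x + y).
Proof. by case=> _ + Ax Ay => /(_ 1 x y Ax Ay); rewrite scale1r. Qed.

Lemma submodZ A a x : is_submodule A -> A x -> A (a *: x).
Proof. by case=> A0 + Ax => /(_ a x 0 Ax A0); rewrite addr0. Qed.

Lemma submodB A x y : is_submodule A -> A x -> A y -> A (x - y).
Proof.
by move=> sA Ax Ay; rewrite -scaleN1r; apply: submodD => //; exact: submodZ.
Qed.

Lemma submod_sum A (I : Type) (r : seq I) (P : pred I) (F : I -> M) :
  is_submodule A -> (forall i, P i -> A (F i)) -> A (\sum_(i <- r | P i) F i).
Proof. by move=> sA AF; elim/big_ind: _ => // [|x y]; [case: sA|exact: submodD]. Qed.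

Lemma generated_submodule A : is_submodule (generated A).
Proof.
split=> [|a x y gx gy B [sB AB]]; first by move=> B [[]].
by case: (sB) => _; apply; [exact: gx|exact: gy].
Qed.

Lemma generated_ind A (B : set M) x :
  is_submodule B -> A `<=` B -> generated A x -> B x.
Proof. by move=> sB AB gx; exact: (smallest_sub sB AB). Qed.

Lemma generatedZ A a x : generated A x -> generated A (a *: x).
Proof. exact: (submodZ _ (generated_submodule A)). Qed.

Lemma generated_sum A (I : Type) (r : seq I) (F : I -> M) :
  (forall i, generated A (F i)) -> generated A (\sum_(i <- r) F i).
Proof. by move=> AF; apply: submod_sum => //; exact: generated_submodule. Qed.

Lemma span_submodule (n : nat) (x : 'I_n -> M) :
  is_submodule [set u | exists c : 'I_n -> R, u = \sum_i c i *: x i].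
Proof.
split=> [|a _ _ [c ->] [d ->]].
  by exists (fun=> 0); rewrite big1 // => i _; rewrite scale0r.
exists (fun i => a * c i + d i); rewrite scaler_sumr -big_split /=.
by apply: eq_bigr => i _; rewrite scalerDl scalerA.
Qed.

Lemma line_submodule (y : M) : is_submodule [set u | exists c : R, u = c *: y].
Proof.
split=> [|a _ _ [c ->] [d ->]]; first by exists 0; rewrite scale0r.
by exists (a * c + d); rewrite scalerDl scalerA.
Qed.

Lemma generated_seqP s x :
  generated [set` s] x <-> exists c : 'I_(size s) -> R, x = \sum_i c i *: s`_i.
Proof.
split=> [|[c ->]]; last first.
  apply: generated_sum => i; apply: generatedZ.
  by apply: sub_gen_smallest => /=; exact: mem_nth.
apply: (generated_ind (span_submodule (fun i : 'I_(size s) => s`_i))).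
move=> y /= ys; have lt_ys : (index y s < size s)%N by rewrite index_mem.
exists (fun i => (i == Ordinal lt_ys)%:R).
rewrite (bigD1 (Ordinal lt_ys)) //= eqxx scale1r nth_index //.
by rewrite big1 ?addr0 // => i /negbTE ->; rewrite scale0r.
Qed.

Lemma generated1P (x y : M) : generated [set x] y <-> exists r : R, y = r *: x.
Proof.
split=> [|[r ->]]; last first.
  by apply: generatedZ; exact: sub_gen_smallest.
by apply: (generated_ind (line_submodule x)) => _ ->; exists 1; rewrite scale1r.
Qed.

Lemma fin_genP A :
  fin_gen A <-> exists n (x : 'I_n -> M),
    A = [set y | exists c : 'I_n -> R, y = \sum_i c i *: x i].
Proof.
split=> [[X /finite_seqP [s ->] ->]|[n [x ->]]].
  exists (size s), (fun i => s`_i); apply/seteqP.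
  by split=> y /generated_seqP.
exists [set` codom x]; first exact: finite_seq.
apply/seteqP; split=> y /=; last first.
  apply: (generated_ind (span_submodule x)) => _ /codomP [i ->] /=.
  exists (fun j => (j == i)%:R); rewrite (bigD1 i) //= eqxx scale1r.
  by rewrite big1 ?addr0 // => j /negbTE ->; rewrite scale0r.
move=> [c ->]; apply: generated_sum => i; apply: generatedZ.
by apply: sub_gen_smallest => /=; exact: codom_f.
Qed.

End Submodules.

Definition divides (R : comNzRingType) (a x : R) := exists r, x = r * a.

Section Divides.
Variable R : comNzRingType.
Implicit Types a b x y : R.

Lemma divides_refl a : divides a a. Proof. by exists 1; rewrite mul1r. Qed.
Lemma divides_trans a b x : divides a b -> divides b x -> divides a x.
Proof. by move=> [r ->] [s ->]; exists (s * r); rewrite mulrA. Qed.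
Lemma divides0 a : divides a 0. Proof. by exists 0; rewrite mul0r. Qed.
Lemma dividesD a x y : divides a x -> divides a y -> divides a (x + y).
Proof. by move=> [r ->] [s ->]; exists (r + s); rewrite mulrDl. Qed.
Lemma dividesMl a x y : divides a y -> divides a (x * y).
Proof. by move=> [r ->]; exists (x * r); rewrite mulrA. Qed.
Lemma dividesN a x : divides a x -> divides a (- x).
Proof. by move=> [r ->]; exists (- r); rewrite mulNr. Qed.
Lemma dividesB a x y : divides a x -> divides a y -> divides a (x - y).
Proof. by move=> ax ay; apply: dividesD => //; exact: dividesN. Qed.
Lemma divides_submodule a : is_submodule ([set x | divides a x] : set R^o).
Proof.
split=> [|r x y ax ay]; first exact: divides0.
by apply: dividesD => //; exact: dividesMl.
Qed.

Definition Rideal a : ideal R := Submodule (divides_submodule a).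

Lemma annihilator_submodule (S : set R^o) : is_submodule (annihilator_of S).
Proof.
split=> [a _|c x y Sx Sy a Sa]; first by rewrite mul0r.
by rewrite mulrDl -mulrA Sx // Sy // mulr0 addr0.
Qed.

Lemma principal_idealP a x : principal_ideal a x <-> divides a x.
Proof. by split=> [[r _ <-]|[r ->]]; [exists r|exists r]. Qed.

Lemma generated1_ideal (a : R^o) : generated [set a] = principal_ideal a :> set R.
Proof.
apply/seteqP; split=> x.
  by move=> /generated1P [r ->]; exists r.
by move=> [r _ <-]; apply/generated1P; exists r.
Qed.

Lemma fin_gen_principal a : fin_gen (principal_ideal a : set R^o).
Proof.
by exists [set (a : R^o)]; [exact: finite_set1|rewrite generated1_ideal].
Qed.

End Divides.

(** * Ideals of a valuation ring *)

(** Elementwise form of [(0 : (0 : r)) = R r]; the inclusion from right to left is automatic. *)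
Definition double_annihilator (R : comNzRingType) :=
  forall r x : R, (forall s, s * r = 0 -> s * x = 0) -> divides r x.

(** [S] is any subset, so that singletons, [P] and unions of annihilators are covered directly. *)
Definition principal_annihilators (R : comNzRingType) :=
  forall S : set R, exists b, forall r : R,
    (forall a, S a -> r * a = 0) <-> divides b r.

Section ValuationRing.
Variables (R : comNzRingType) (P : ideal R).
Hypotheses (val_R : valuation_ring R) (max_P : maximal_ideal P).
Implicit Types (a b p q r s t u x y z : R) (S : set R) (A : ideal R).

Lemma idealZl A r x : (A : set R) x -> (A : set R) (r * x).
Proof. by move=> Ax; apply: (submodZ (M := R^o)) => //; exact: submoduleP. Qed.

Lemma idealZr A r x : (A : set R) x -> (A : set R) (x * r).
Proof. by rewrite mulrC; exact: idealZl. Qed.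

Lemma divides_total x y : divides x y \/ divides y x.
Proof.
case: (val_R (Rideal x) (Rideal y)) => h; [right|left]; apply: h => /=;
  exact: divides_refl.
Qed.

Lemma divides_notin A x a : ~ (A : set R) x -> (A : set R) a -> divides x a.
Proof.
move=> nAx Aa; case: (divides_total x a) => // -[r xE].
by case: nAx; rewrite xE; exact: idealZl.
Qed.

Lemma ideal_divides A a x : (A : set R) a -> divides a x -> (A : set R) x.
Proof. by move=> Aa [r ->]; exact: idealZl. Qed.

Lemma P_neq1 : ~ (P : set R) 1.
Proof.
move=> P1; case: max_P => nP _; apply: nP; apply/seteqP; split => // x _.
by rewrite -[x]mulr1; exact: idealZl.
Qed.

Lemma notin_unit x : ~ (P : set R) x -> exists y, y * x = 1.
Proof.
move=> nPx; case: max_P => _ /(_ (Rideal x)) h.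
case: (pselect (divides x 1)) => [[y yE]|nx1]; first by exists y; rewrite -yE.
exfalso; apply: (nPx); suff <- : Rideal x = P :> set R by exact: divides_refl.
apply: h => [E|p Pp]; last exact: divides_notin nPx Pp.
by apply: nx1; suff : (Rideal x : set R) 1 by []; rewrite E.
Qed.

Lemma notin_reg x y : ~ (P : set R) x -> x * y = 0 -> y = 0.
Proof.
by move=> /notin_unit [z zx] xy; rewrite -[y]mul1r -zx -mulrA xy mulr0.
Qed.

(** Nakayama's argument: [1 - p] is a unit. *)
Lemma mulP_fixed p x : (P : set R) p -> x = p * x -> x = 0.
Proof.
move=> Pp xE; apply: (@notin_reg (1 - p)); last by rewrite mulrBl mul1r -xE subrr.
move=> P1p; apply: P_neq1; rewrite -(subrK p 1).
by apply: (submodD (M := R^o)) => //; exact: submoduleP.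
Qed.

Lemma divides_mulP p x : (P : set R) p -> divides (p * x) x -> x = 0.
Proof.
move=> Pp [r xE]; apply: (@mulP_fixed (r * p)); first exact: idealZl.
by rewrite -mulrA.
Qed.

(** If [x = p y] with [p] outside [P], then [p] is a unit and [x] divides [y]; so failure of
    divisibility always yields a cofactor in [P]. *)
Lemma divides_cases x y : divides x y \/ exists2 p, (P : set R) p & x = p * y.
Proof.
case: (divides_total x y) => [|[p xE]]; first by left.
case: (pselect ((P : set R) p)) => [Pp|/notin_unit [u up]].
  by right; exists p.
by left; exists u; rewrite xE mulrA up mul1r.
Qed.

Lemma divides_not x y : ~ divides x y -> exists2 p, (P : set R) p & x = p * y.
Proof. by case: (divides_cases x y). Qed.

Lemma divides_min (I : eqType) (s : seq I) (a : I -> R) : s != [::] ->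
  exists2 i, i \in s & forall j, j \in s -> divides (a i) (a j).
Proof.
elim: s => // i [|j s] IH _.
  by exists i; rewrite ?mem_head // => j; rewrite inE => /eqP ->; exact: divides_refl.
have [//|k ks kmin] := IH; have [ik|ki] := divides_total (a i) (a k).
  exists i; rewrite ?mem_head // => l; rewrite inE => /predU1P [->|ls].
    exact: divides_refl.
  exact: divides_trans (kmin l ls).
exists k; first by rewrite inE ks orbT.
by move=> l; rewrite inE => /predU1P [->|ls] //; exact: kmin.
Qed.

Lemma divides_min_ord n (a : 'I_n.+1 -> R) : exists i, forall j, divides (a i) (a j).
Proof.
have [|i _ h] := @divides_min _ (enum 'I_n.+1) a.
  by rewrite -size_eq0 size_enum_ord.
by exists i => j; apply: h; rewrite mem_enum.
Qed.

Lemma fin_gen_ideal (A : set R^o) : fin_gen A -> exists a : R, A = principal_ideal a.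
Proof.
move=> /fin_genP [[|n] [x ->]].
  exists 0; apply/seteqP; split=> y /=.
    by move=> [c ->]; rewrite big_ord0; apply/principal_idealP; exact: divides0.
  by move=> [r _ <-]; exists (fun=> 0); rewrite big_ord0 mulr0.
have [i imin] := divides_min_ord x; exists (x i); apply/seteqP; split=> y /=.
  move=> [c ->]; apply/principal_idealP.
  have sub := divides_submodule (x i); apply: (submod_sum _ sub) => j _ /=.
  exact: (dividesMl (c j) (imin j)).
move=> [r _ <-]; exists (fun j => r * (j == i)%:R).
rewrite (bigD1 i) //= eqxx mulr1 big1 ?addr0 // => j /negbTE ->.
by rewrite mulr0 scale0r.
Qed.

Lemma P_notprincipal p : ~ is_principal_ideal P -> (P : set R) p ->
  exists q r, [/\ (P : set R) q, (P : set R) r & p = q * r].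
Proof.
move=> nP Pp; suff [q Pq /divides_not [r Pr ->]] : exists2 q, (P : set R) q & ~ divides p q.
  by exists r, q.
apply: contrapT => h; apply: nP; exists p; apply/seteqP; split=> x.
  move=> Px; apply/principal_idealP; apply: contrapT => nx.
  by apply: h; exists x.
by move=> /principal_idealP; exact: ideal_divides.
Qed.

Lemma zero_divisors_max : principal_annihilators R -> zero_divisors R <> [set 0] ->
  forall p, (P : set R) p -> exists2 x, x <> 0 & p * x = 0.
Proof.
move=> annR Zn0 s Ps; apply: contrapT => regs.
have {}regs x : s * x = 0 -> x = 0.
  by move=> sx; apply: contrapT => nx; apply: regs; exists x.
have [z [w [nz nw zw]]] : exists z w : R, [/\ z <> 0, w <> 0 & z * w = 0].
  apply: contrapT => h; apply: Zn0; apply/seteqP; split=> [z [w nw zw]|z ->] /=.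
    by apply: contrapT => nz; apply: h; exists z, w.
  by exists 1; [exact/eqP/oner_neq0|rewrite mul0r].
have [y yP] := annR [set z].
have [r wE] : divides y w by apply: (yP w).1 => _ ->; rewrite mulrC.
have yz : y * z = 0 by exact: (yP y).2 (divides_refl y) z erefl.
apply: nw; rewrite wE; suff -> : y = 0 by rewrite mulr0.
(* If [s = t y], then [s z = 0] contradicts regularity. If [y = y' s], then [y'] kills [z] because
   [s] is regular, so [y' = c y], and [y = c s y] vanishes. *)
case: (divides_total s y) => [[y' yE]|[t sE]]; last first.
  by case: nz; apply: regs; rewrite sE -mulrA yz mulr0.
have [c y'E] : divides y y'.
  by apply: (yP y').1 => _ ->; apply: regs; rewrite mulrA (mulrC s) -yE.
apply: (@divides_mulP s) => //; exists c.
by rewrite {1}yE y'E; ring.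
Qed.

Section ZeroDivisors.
Hypothesis PZ : forall p, (P : set R) p -> exists2 x, x <> 0 & p * x = 0.

(** Otherwise [r = t x] with [t] in [P], and [t s = 0] for some [s <> 0]. If [x = a s], then
    [r = 0], which forces [x = 0]. If [s = a x], then [a r = t s = 0], hence [s = a x = 0]. *)
Lemma PZ_double_annihilator : double_annihilator R.
Proof.
move=> r x h; apply: contrapT => nrx; have [t Pt rE] := divides_not nrx.
have [s ns ts] := PZ Pt; have [[a xE]|[a sE]] := divides_total s x.
  have r0 : r = 0 by rewrite rE xE mulrCA ts mulr0.
  apply: nrx; have := h 1; rewrite !mul1r => -> //; exact: divides0.
by apply: ns; rewrite sE; apply: h; rewrite rE mulrCA -sE.
Qed.

End ZeroDivisors.
End ValuationRing.

Definition principal_intersections (R : comNzRingType) :=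
  forall S : set R, S !=set0 -> exists b, forall x : R,
    (forall t, S t -> divides t x) <-> divides b x.

(** As [R t = (0 : (0 : t))], the intersection of the [R t] is the annihilator of the union of the
    [(0 : t)]. *)
Lemma double_annihilator_intersections (R : comNzRingType) :
  double_annihilator R -> principal_annihilators R -> principal_intersections R.
Proof.
move=> dann annR S _.
have [b bP] := annR [set s | exists2 t, S t & s * t = 0].
exists b => x; rewrite -bP; split=> [h a [t St at0]|h t St].
  by have [r ->] := h t St; rewrite -mulrA (mulrC t) at0 mulr0.
by apply: dann => s st; rewrite mulrC; apply: h; exists t.
Qed.

(** * Shape of the ideals and of the maximal ideal *)

Section Structure.
Variables (R : comNzRingType) (P : ideal R).
Hypotheses (val_R : valuation_ring R) (max_P : maximal_ideal P).
Implicit Types (a b p q r s t u x y z : R) (S : set R) (A : ideal R).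

Let mulP0 := divides_mulP val_R max_P.
Let dcases := divides_cases val_R max_P.

Lemma ideal_mulrP A a x :
  ideal_mulr A a x <-> exists2 p, (A : set R) p & x = p * a.
Proof. by split=> [[p Ap <-]|[p Ap ->]]; exists p. Qed.

(** Let [R c] be the intersection of the principal ideals containing [A]. If [c] is in [A], then
    [A = R c]. Otherwise [A] lies in [P c]; an element [p c] outside [A] would put [A] inside
    [R p c], making [c] a multiple of [p c], hence zero. *)
Lemma intersections_ideals : principal_intersections R ->
  forall A, exists a, A = principal_ideal a :> set R \/ A = ideal_mulr P a :> set R.
Proof.
move=> int A; have [|c cP] := int [set t | forall x, (A : set R) x -> divides t x].
  by exists 1 => x _; exists x; rewrite mulr1.
exists c; have sAc x : (A : set R) x -> divides c x by move=> Ax; apply/cP => t; exact.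
case: (pselect ((A : set R) c)) => [Ac|nAc].
  left; apply/seteqP; split=> x; first by move=> /sAc ?; exact/principal_idealP.
  by move=> /principal_idealP; exact: ideal_divides.
right; apply/seteqP; split=> x.
  move=> Ax; case: (dcases x c) => [xc|[p Pp ->]].
    by case: nAc; exact: ideal_divides xc.
  by apply/ideal_mulrP; exists p.
move=> /ideal_mulrP [p Pp ->]; apply: contrapT => npc.
have /(mulP0 Pp) c0 : divides (p * c) c.
  apply: ((cP c).2 (divides_refl c)) => y Ay.
  exact: (divides_notin val_R) npc Ay.
by apply: nAc; rewrite c0; case: (submoduleP A).
Qed.

(** Write [(0 : P) = R b]. If [b <> 0], then [P = (0 : b)], since elements outside [P] are units,
    and [(0 : b)] is principal. *)
Lemma annihilators_P : principal_annihilators R ->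
  is_principal_ideal P \/ faithful_ideal P.
Proof.
move=> annR; have [b bP] := annR (P : set R).
case: (pselect (b = 0)) => [b0|nb0]; [right|left].
  apply/seteqP; split=> x /=; last by move=> -> a _; rewrite mul0r.
  by move=> /(bP x).1 [r ->]; rewrite b0 mulr0.
have [c cP] := annR [set b]; exists c.
have bP0 p : (P : set R) p -> b * p = 0 by exact: (bP b).2 (divides_refl b) p.
apply/seteqP; split=> p.
  move=> Pp; apply/principal_idealP; apply: (cP p).1 => _ ->.
  by rewrite mulrC bP0.
move=> /principal_idealP /(cP p).2 /(_ b erefl) pb; apply: contrapT => nPp.
by apply: nb0; exact: notin_reg nPp pb.
Qed.

Lemma faithfulP (A : set R^o) : faithful_ideal A ->
  forall x, (forall a, A a -> x * a = 0) -> x = 0.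
Proof.
by move=> fA x h; have : annihilator_of A x by []; rewrite fA.
Qed.

Lemma principal_mulP a : is_principal_ideal P ->
  is_principal_ideal (ideal_mulr P a).
Proof.
move=> [p ->]; exists (p * a); apply/seteqP; split=> x.
  by move=> [_ [r _ <-] <-]; exists r; rewrite ?mulrA.
by move=> [r _ <-]; exists (r * p); [exists r|rewrite mulrA].
Qed.

(* If [(0:S) = Pb] with [P] faithful, then [b] itself kills [S]. *)
Lemma ideals_annihilators : is_principal_ideal P \/ faithful_ideal P ->
  (forall A, exists a, A = principal_ideal a :> set R \/ A = ideal_mulr P a :> set R) ->
  principal_annihilators R.
Proof.
move=> pfP idR S.
have sA := annihilator_submodule S.
suff [b bE] : is_principal_ideal (annihilator_of S).
  by exists b => r; rewrite -principal_idealP -bE.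
have [b /= [->|bE]] := idR (Submodule sA); first by exists b.
case: pfP => [/(principal_mulP b)|fP]; first by rewrite bE.
exists 0; apply/seteqP; split=> [x|x [r _ <-] a _]; last by rewrite mulr0 mul0r.
suff b0 : b = 0.
  by rewrite bE => /ideal_mulrP [p _ ->]; apply/principal_idealP; exists p; rewrite b0.
have : ideal_mulr P b b.
  rewrite -bE /= => a Sa; apply: (faithfulP fP) => p Pp.
  have : ideal_mulr P b (p * b) by apply/ideal_mulrP; exists p.
  by rewrite -bE => /(_ a Sa) E; rewrite mulrC mulrA.
by move=> /ideal_mulrP [p Pp]; exact: (mulP_fixed val_R max_P).
Qed.

End Structure.

(** * Maximality and extension of partial homomorphisms *)

Section FiniteIntersection.
Variable R : comNzRingType.
Hypothesis val_R : valuation_ring R.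

Lemma ring_cosetP (a x : R) (A : ideal R) :
  ring_coset a A x <-> (A : set R) (x - a).
Proof.
split=> [[y Ay <-]|Axa]; first by rewrite addrC addKr.
by exists (x - a) => //; rewrite addrC subrK.
Qed.

(* In a valuation ring pairwise intersections suffice: two cosets which meet
   are comparable. *)
Lemma maximal_ring_nested : maximal_ring R ->
  forall (I : Type) (a : I -> R) (L : I -> ideal R),
    (forall i j, L i `<=` L j -> (L j : set R) (a i - a j)) ->
  exists w, forall i, (L i : set R) (w - a i).
Proof.
move=> maxR I a L nest; suff [w wP] : \bigcap_i ring_coset (a i) (L i) !=set0.
  by exists w => i; apply/ring_cosetP/wP.
apply: maxR => J finJ.
suff [J0|[i Ji imin]] : (J = set0 \/ exists2 i, J i & forall j, J j -> L i `<=` L j).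
- by exists 0 => j; rewrite J0.
- by exists (a i) => j Jj; apply/ring_cosetP/nest/imin.
case: (pselect (J !=set0)) => [|/set0P/negP/negPn/eqP]; last by left.
move=> [i0 Ji0]; right; move: Ji0.
have [n [f ->]] : exists n (f : 'I_n -> {classic I}), J = range f.
  exact: (@finite_set_family {classic I}).
case: n f => [f [[]]|n f _] //.
suff [i imin] : exists i, forall j, L (f i) `<=` L (f j).
  by exists (f i) => // j [k _ <-].
elim: n f => [|n IH] f; first by exists ord0 => j; rewrite (ord1 j).
have [i imin] := IH (fun k => f (lift ord0 k)).
case: (val_R (L (f ord0)) (L (f (lift ord0 i)))) => h.
  by exists ord0 => j; case: (unliftP ord0 j) => [k ->|->] // x /h; exact: imin.
by exists (lift ord0 i) => j; case: (unliftP ord0 j) => [k ->|->].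
Qed.

Lemma ann_ideal_subproof (r : R) :
  is_submodule ([set s : R | s * r = 0] : set R^o).
Proof.
split=> [|c x y /= xr yr]; first by rewrite /= mul0r.
by rewrite mulrDl -mulrA xr yr mulr0 addr0.
Qed.

Definition ann_ideal r : ideal R := Submodule (ann_ideal_subproof r).

(** [H] is the graph of a homomorphism from an ideal to [R]. By the double annihilator condition its
    value at [r] is a multiple [r t]. The admissible multipliers at [r] form the coset
    [t + (0 : r)]; these cosets are nested, and maximality gives a common multiplier. *)
Lemma baer_extension : double_annihilator R -> maximal_ring R ->
  forall H : set (R^o * R^o), is_submodule H -> (forall s, H (0, s) -> s = 0) ->
  exists c, forall r s, H (r, s) -> s = r * c.
Proof.
move=> dann maxR H sH H0.
have Hdiv r s : H (r, s) -> divides r s.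
  move=> Hrs; apply: dann => t tr; apply: H0.
  by rewrite -tr; exact: (submodZ t sH Hrs).
pose I := {p : R * R | `[< H (p.1, p.1 * p.2) >]}.
have IP (i : I) : H ((val i).1, (val i).1 * (val i).2) by exact/asboolP/(valP i).
have [|c cP] := maximal_ring_nested maxR (a := fun i : I => (val i).2)
  (L := fun i : I => ann_ideal (val i).1).
  move=> i j ij; have [t jE] : divides (val i).1 (val j).1.
    by apply: dann => s /ij /=.
  have := submodB sH (IP j) (submodZ t sH (IP i)).
  rewrite /= [X in H X](_ : _ = (0, (val j).1 * ((val j).2 - (val i).2))).
    move=> /H0 E; apply: oppr_inj; rewrite oppr0 -E; ring.
  by congr pair; [rewrite /= jE; exact: subrr|rewrite /= jE /GRing.scale /=; ring].
exists c => r s Hrs; have [t sE] := Hdiv _ _ Hrs.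
have Hi : `[< H (r, r * t) >] by apply/asboolP; rewrite mulrC -sE.
have /= := cP (exist _ (r, t) Hi); rewrite mulrBl => /eqP; rewrite subr_eq0 => /eqP.
by rewrite sE mulrC => ->.
Qed.

End FiniteIntersection.

(** * Self-injectivity *)

Section Injectivity.
Variable R : comNzRingType.

(* Baer's criterion; a partial homomorphism is represented by its graph. *)
Lemma baer_injective :
  (forall H : set (R^o * R^o), is_submodule H -> (forall s, H (0, s) -> s = 0) ->
     exists c, forall r s : R, H (r, s) -> s = r * c) ->
  self_injective R.
Proof.
move=> baer A B f g injf.
pose G0 : set (B * R^o) := [set p | exists a, p = (f a, g a)].
pose good := [set G : set (B * R^o) | [/\ is_submodule G, G0 `<=` G &
  forall s, G (0, s) -> s = 0]].
have good0 : good G0.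
  split=> //; last first.
    by move=> s [a [fa ->]]; rewrite (injf a 0) ?linear0.
  split=> [|c _ _ [a ->] [b ->]]; first by exists 0; rewrite !linear0.
  by exists (c *: a + b); rewrite !linearP.
(* Zorn's lemma runs over the sets whose union with [G0] is good, so that the empty chain is bounded
   too. *)
have [|G [Ggood Gmax]] := @Zorn_bigcup _ [set G | good (G0 `|` G)].
  move=> F Fgood totF; rewrite /=.
  have [->|/set0P [G1 FG1]] := eqVneq F set0.
    by rewrite bigcup_set0 setU0.
  rewrite -bigcupUr //; last by exists G1.
  split.
  - split=> [|c x y [G2 FG2 G2x] [G3 FG3 G3y]].
      by exists G1 => //; have [[]] := Fgood _ FG1.
    have [G23|G32] := totF _ _ FG2 FG3.
      exists G3 => //; have [sG _ _] := Fgood _ FG3; case: (sG) => _; apply=> //.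
      by case: G2x => [|/G23]; [left|right].
    exists G2 => //; have [sG _ _] := Fgood _ FG2; case: (sG) => _; apply=> //.
    by case: G3y => [|/G32]; [left|right].
  - by move=> p G0p; exists G1 => //; left.
  - by move=> s [G2 FG2 G2s]; have [_ _] := Fgood _ FG2; exact.
have {G Ggood Gmax} [G [sG G0G fG] Gmax] :
    exists2 G, good G & forall G', good G' -> G `<=` G' -> G' `<=` G.
  exists (G0 `|` G) => // G' G'good GG' p G'p; right; apply: contrapT => nGp.
  have G0G' : G0 `<=` G' by have [] := G'good.
  apply: (Gmax G'); last by rewrite /= (setUidPr _ _).2.
  by split=> [q Gq|/(_ _ G'p)//]; apply: GG'; right.
have Gfun b s t : G (b, s) -> G (b, t) -> s = t.
  move=> Gs Gt; apply/eqP; rewrite -subr_eq0; apply/eqP/fG.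
  by have := submodB sG Gs Gt; rewrite [X in G X](_ : _ = (0, s - t)) //;
    congr pair; exact: subrr.
(* The partial homomorphism sending [r] to the value of [G] at [r b] is multiplication by some [c].
   Adjoining the value [c] at [b] is then consistent, and maximality puts [b] in the domain. *)
have Gtot b : exists s, G (b, s).
  have [||c cP] := baer [set p | G (p.1 *: b, p.2)].
  - split=> /= [|c x y Gx Gy]; first by rewrite scale0r; case: sG.
    have := submodD sG (submodZ c sG Gx) Gy.
    by congr (G (_, _)); rewrite /= scalerA -scalerDl.
  - by move=> s /=; rewrite scale0r; exact: fG.
  exists c; apply: (Gmax [set p | exists q r, G q /\ p = (q.1 + r *: b, q.2 + r * c)]).
  - split.
    + split=> [|e _ _ [[q1 q2] [r [Gq ->]]] [[q1' q2'] [r' [Gq' ->]]]].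
        exists 0, 0; split; first by case: sG.
        by congr pair; [rewrite scale0r addr0|rewrite mul0r addr0].
      exists (e *: q1 + q1', e *: q2 + q2'), (e * r + r'); split.
        exact: (submodD sG (submodZ e sG Gq) Gq').
      congr pair => /=; first by rewrite scalerDr scalerDl scalerA addrACA.
      rewrite /GRing.scale /=; ring.
    + by move=> p /G0G Gp; exists p, 0; split=> //; case: p Gp => ? ? _;
        congr pair; rewrite ?scale0r ?mul0r addr0.
    + move=> s [[q1 q2] [r [Gq [/= E ->]]]].
      have := cP (- r) q2; rewrite /= scaleNr.
      have -> : - (r *: b) = q1 by apply/eqP; rewrite eq_sym -addr_eq0 -E.
      by move=> /(_ Gq) ->; rewrite mulNr addNr.
  - by move=> p Gp; exists p, 0; split=> //; case: p Gp => ? ? _;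
        congr pair; rewrite ?scale0r ?mul0r addr0.
  - exists 0, 1; split; first by case: sG.
    by congr pair; rewrite ?scale1r ?mul1r add0r.
pose h b := projT1 (cid (Gtot b)).
have Gh b : G (b, h b) by rewrite /h; case: cid.
have lh : linear (h : B -> R^o).
  move=> a x y; apply: (Gfun (a *: x + y)) => //.
  by have := submodD sG (submodZ a sG (Gh x)) (Gh y).
have [h' h'E] := linear_bundle lh; exists h' => x.
by rewrite h'E; apply: (Gfun (f x)) => //; apply: G0G; exists x.
Qed.

End Injectivity.

(** * Trace modules *)

(* Over a local ring a single functional suffices in the usual definition
   [x \in M^*(x) M] of a trace module. *)
Definition trace_module (R : comNzRingType) (M : lmodType R) :=
  forall x : M, exists (f : {linear M -> R^o}) (y : M), x = f x *: y.

Lemma row_free_module (R : comNzRingType) n : free_module 'rV[R]_n.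
Proof.
exists (range (fun i => delta_mx 0 i)); split.
  apply/seteqP; split=> // v _; rewrite [v]row_sum_delta.
  by apply: generated_sum => i; apply: generatedZ; apply: sub_gen_smallest; exists i.
move=> s a us sB E x xs; have [i _ xE] := sB x xs.
have := congr1 (fun v : 'rV_n => v 0 i) E; rewrite mxE summxE (bigD1_seq x) //=.
rewrite big_seq_cond big1 ?addr0 => [|x' /andP[x's x'x]].
  by rewrite mxE -xE mxE !eqxx mulr1.
have [j _ x'E] := sB x' x's; rewrite mxE -x'E mxE /=.
have [ij|] := eqVneq i j; last by rewrite mulr0.
by rewrite -x'E -xE ij eqxx in x'x.
Qed.

Section LocalRing.
Variables (R : comNzRingType) (P : ideal R).
Hypotheses (val_R : valuation_ring R) (max_P : maximal_ideal P).

Section TraceModule.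
Variable M : lmodType R.

(** Elimination, one vector at a time: [pr] projects onto the common kernel of the functionals found
    so far. If [pr x = g (pr x) *: pr z] is nonzero, then [g (pr z)] is a unit, because
    multiplication by it fixes [g (pr x)]; so [pr z] and a rescaling of [g] after [pr] join the
    system. *)
Lemma trace_dual_basis (s : seq M) : trace_module M ->
  exists m (y : 'I_m -> M) (f : 'I_m -> {linear M -> R^o}),
    (forall i j, f i (y j) = (i == j)%:R) /\
    forall x, x \in s -> x = \sum_i f i x *: y i.
Proof.
move=> trM; elim: s => [|x s [m [y [f [fy sE]]]]].
  by exists 0, (fun=> 0), (fun=> \0); split=> [[]|].
pose pr (u : M) := u - \sum_i f i u *: y i.
have prl : linear pr.
  move=> a u v; rewrite /pr scalerBr scaler_sumr.
  under eq_bigr do rewrite linearP scalerDl -scalerA.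
  by rewrite big_split /= opprD addrACA.
have fpr i u : f i (pr u) = 0.
  rewrite linearB linear_sum /= (bigD1 i) //= linearZ fy eqxx /= regularZE mulr1.
  rewrite big1 ?addr0 ?subrr // => j /negbTE ji.
  by rewrite linearZ fy eq_sym ji /= scaler0.
have prK u : pr (pr u) = pr u.
  by rewrite {1}/pr big1 ?subr0 // => i _; rewrite fpr scale0r.
have pry i : pr (y i) = 0.
  rewrite /pr (bigD1 i) //= fy eqxx scale1r big1 ?addr0 ?subrr // => j.
  by move=> /negbTE ij; rewrite fy ij scale0r.
have [pr' pr'E] := linear_bundle prl.
have prS u : u \in s -> pr u = 0 by move=> us; rewrite /pr -sE ?subrr.
have [px0|/eqP px0] := eqVneq (pr x) 0.
  exists m, y, f; split=> // u; rewrite inE => /predU1P [->|]; last exact: sE.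
  by apply/eqP; rewrite -subr_eq0; apply/eqP.
have [g [z xz]] := trM (pr x).
have {}xz : pr x = g (pr x) *: pr z.
  by rewrite -{1}prK {1}xz -pr'E linearZ /= pr'E.
have gx : g (pr x) = g (pr z) * g (pr x).
  by rewrite {1}xz linearZ /= regularZE mulrC.
have [c cgz] : exists c, c * g (pr z) = 1.
  apply: (notin_unit val_R max_P) => Pgz; apply: px0.
  by rewrite xz (mulP_fixed val_R max_P Pgz gx) scale0r.
have hl : linear (fun u => c *: g (pr u) : R^o).
  by move=> a u v; rewrite prl linearP scalerDr !scalerA mulrC.
have [h hE] := linear_bundle hl.
exists m.+1, (fun i => oapp y (pr z) (unlift ord0 i)),
  (fun i => oapp f h (unlift ord0 i)); split.
  move=> i j; case: (unliftP ord0 i) => [i' ->|->] /=;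
    case: (unliftP ord0 j) => [j' ->|->] /=.
  - by rewrite fy (inj_eq (@lift_inj _ ord0)).
  - by rewrite fpr.
  - by rewrite hE pry linear0 scaler0.
  - by rewrite hE prK; exact: cgz.
move=> u; rewrite big_ord_recl unlift_none /= hE.
under eq_bigr do rewrite liftK /=.
rewrite inE => /predU1P [->|us]; last by rewrite prS // linear0 scaler0 scale0r add0r -sE.
suff -> : c *: g (pr x) = g (pr x) by rewrite -xz subrK.
by rewrite {1}gx regularZE mulrA cgz mul1r.
Qed.

Lemma trace_dual_basis_ord n (x : 'I_n -> M) : trace_module M ->
  exists m (y : 'I_m -> M) (f : 'I_m -> {linear M -> R^o}),
    (forall i j, f i (y j) = (i == j)%:R) /\
    forall k, x k = \sum_i f i (x k) *: y i.
Proof.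
move=> /(trace_dual_basis (codom x)) [m [y [f [fy xE]]]].
by exists m, y, f; split=> // k; apply/xE/codom_f.
Qed.

Lemma trace_locally_projective : trace_module M -> locally_projective M.
Proof.
move=> trM N /fin_genP [n [x NE]].
have [m [y [f [fy xE]]]] := trace_dual_basis_ord x trM.
have phil : linear (fun u => \row_i (f i u : R) : 'rV[R]_m).
  by move=> a u v; apply/rowP => i; rewrite !mxE linearP.
have pil : linear (fun v : 'rV[R]_m => \sum_i v 0 i *: y i : M).
  move=> a u v; rewrite scaler_sumr -big_split; apply: eq_bigr => i _ /=.
  by rewrite !mxE scalerDl scalerA.
have [phi phiE] := linear_bundle phil; have [pi piE] := linear_bundle pil.
exists 'rV[R]_m, phi, pi; split; first exact: row_free_module.
move=> u; rewrite NE => -[c ->]; rewrite !linear_sum; apply: eq_bigr => k _.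
rewrite !linearZ /= piE phiE {2}(xE k); congr (_ *: _).
by apply: eq_bigr => i _; rewrite mxE.
Qed.

Lemma locally_projective_singly : locally_projective M -> singly_projective M.
Proof.
move=> lpM N [x NE]; have [|F [phi [pi [freeF piphi]]]] := lpM N.
  by exists [set x] => //; exact: finite_set1.
have ul : linear (fun v : submod N => phi (val v)).
  by move=> a u v; rewrite !linearP.
have [u uE] := linear_bundle ul; exists F, u, pi; split=> // v.
by rewrite uE piphi //; exact/set_mem/(valP v).
Qed.

Lemma cyclic_uniserial (U : submodule M) (y : M) :
  (forall u, (U : set M) u -> exists r, u = r *: y) -> uniserial (submod U).
Proof.
move=> Uy A B; case: (pselect (A `<=` B)) => [|nAB]; [by left|right=> b Bb].
have [a Aa nBa] : exists2 a, (A : set _) a & ~ (B : set _) a.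
  by apply: contrapT => h; apply: nAB => a Aa; apply: contrapT => nBa; apply: h; exists a.
have [r aE] := Uy _ (set_mem (valP a)); have [s bE] := Uy _ (set_mem (valP b)).
have [[t st]|[t rt]] := divides_total val_R r s.
  suff -> : b = t *: a by apply: submodZ => //; exact: submoduleP.
  by apply: val_inj; rewrite /= bE aE scalerA st.
case: nBa; suff -> : a = t *: b by apply: submodZ => //; exact: submoduleP.
by apply: val_inj; rewrite /= bE aE scalerA rt.
Qed.

Lemma trace_separable : trace_module M -> separable_module M.
Proof.
move=> trM X /finite_set_family [n [x ->]].
have [m [y [f [fy xE]]]] := trace_dual_basis_ord x trM.
have fsum i (c : 'I_m -> R) : f i (\sum_j c j *: y j) = c i.
  rewrite linear_sum (bigD1 i) //= linearZ fy eqxx /= regularZE mulr1.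
  by rewrite big1 ?addr0 // => j /negbTE ji; rewrite linearZ fy eq_sym ji /= scaler0.
pose D := Submodule (span_submodule y); exists D; split.
- by move=> _ [k _ <-]; exists (fun i => f i (x k)).
- have sE : is_submodule [set u | forall i, f i u = 0].
    by split=> [i|a u v fu fv i]; rewrite ?linear0 // linearP fu fv /= scaler0 addr0.
  exists (Submodule sE); split.
    apply/seteqP; split=> [u [[c ->] /= fu]|_ ->].
      by apply: big1 => i _; move: (fu i); rewrite fsum => ->; rewrite scale0r.
    by split; [case: (submoduleP D)|case: sE].
  apply/seteqP; split=> // u _; exists (\sum_i f i u *: y i).
    by exists (fun i => f i u).
  exists (u - \sum_i f i u *: y i); last by rewrite addrC subrK.
  by move=> i; rewrite linearB /= fsum subrr.
exists m, (fun i => Submodule (line_submodule (y i))); split.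
  by move=> i; apply: (@cyclic_uniserial _ (y i)).
split.
  apply/seteqP; split=> [_ [u uU <-]|_ [c ->]].
    by apply: submod_sum => [|i _]; [exact: span_submodule|];
      have [c ->] := uU i; exists (fun j => c * (i == j)%:R);
      rewrite (bigD1 i) //= eqxx mulr1 big1 ?addr0 // => j; rewrite eq_sym => /negbTE ->;
      rewrite mulr0 scale0r.
  by exists (fun i => c i *: y i) => // i; exists (c i).
move=> u uU u0 i; pose c j := projT1 (cid (uU j)).
have cE j : u j = c j *: y j by rewrite /c; case: cid.
have : f i (\sum_j u j) = c i by under eq_bigr do rewrite cE; exact: fsum.
by rewrite u0 linear0 cE => <-; rewrite scale0r.
Qed.

(** Divisibility being total, a sum [a m + b n] collapses to one product by whichever coefficient
    divides the other. *)
Lemma ideal_mulP (A : set R^o) (x : M) : is_submodule A ->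
  ideal_mul A M x <-> exists2 a : R, A a & exists m : M, x = a *: m.
Proof.
move=> sA; split=> [|[a Aa [m ->]]]; last first.
  by apply: sub_gen_smallest; exists a => //; exists m.
apply: (generated_ind (B := [set x | exists2 a : R, A a & exists m : M, x = a *: m])).
  split=> [|r _ _ [a Aa [m ->]] [b Ab [n ->]]].
    by exists 0; [case: sA|exists 0; rewrite scale0r].
  have [[t ->]|[t ->]] := divides_total val_R a b.
    by exists a => //; exists (r *: m + t *: n); rewrite scalerDr !scalerA (mulrC r) (mulrC t).
  exists b => //; exists ((r * t) *: m + n).
  by rewrite scalerDr !scalerA mulrA (mulrC b).
by move=> _ [a Aa [m _ <-]]; exists a => //; exists m.
Qed.

Lemma content_ideal_submodule (x : M) : is_submodule (content_ideal x).
Proof.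
split=> [A _|a u v cu cv A Ax]; first by case: (submoduleP A).
by case: (submoduleP A) => _; apply; [exact: cu|exact: cv].
Qed.

(** If [x = a m] with [a] in [A], then [f x = a f m] is in [A]; so [f x] lies in the content
    ideal. *)
Lemma trace_content : trace_module M -> content_module M.
Proof.
move=> trM x; have [f [y xE]] := trM x.
apply/(ideal_mulP _ (content_ideal_submodule x)); exists (f x); last by exists y.
move=> A /(ideal_mulP _ (submoduleP A)) [a Aa [m ->]].
by rewrite linearZ; exact: (idealZr _ Aa).
Qed.

End TraceModule.
End LocalRing.

(** * Quotients and flatness *)

Section Quotient.
Variables (R : comNzRingType) (M : lmodType R) (N : submodule M).

Let rel (x y : M) : bool := `[< (N : set M) (x - y) >].
Let rel_refl : reflexive rel.
Proof. by move=> x; apply/asboolP; rewrite subrr; case: (submoduleP N). Qed.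
Let rel_sym : symmetric rel.
Proof.
by move=> x y; apply/asboolP/asboolP => /(submodZ (-1) (submoduleP N));
  rewrite scaleN1r opprB.
Qed.
Let rel_trans : transitive rel.
Proof.
move=> y x z /asboolP xy /asboolP yz; apply/asboolP.
by have := submodD (submoduleP N) xy yz; rewrite addrA subrK.
Qed.
Let relE : equiv_rel M := EquivRel rel rel_refl rel_sym rel_trans.

Definition quotient_module : Type := {eq_quot relE}.
HB.instance Definition _ := Choice.on quotient_module.
HB.instance Definition _ := EqQuotient.on quotient_module.

Definition quotient_proj (x : M) : quotient_module := \pi_quotient_module x.
Let pi := quotient_proj.

Lemma quotient_projP x y : pi x = pi y <-> (N : set M) (x - y).
Proof. by split=> [/eqmodP/asboolP|h] //; apply/eqmodP/asboolP. Qed.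

Let repr_pi x : (N : set M) (repr (pi x) - x).
Proof. by apply/quotient_projP; rewrite /pi /quotient_proj reprK. Qed.

Let piK (t : quotient_module) : pi (repr t) = t. Proof. exact: reprK. Qed.

Let add (s t : quotient_module) := pi (repr s + repr t).
Let opp (s : quotient_module) := pi (- repr s).
Let scale (a : R) (s : quotient_module) := pi (a *: repr s).

Let addE x y : add (pi x) (pi y) = pi (x + y).
Proof.
apply/quotient_projP; rewrite opprD addrACA.
by apply: submodD (submoduleP N) _ _; exact: repr_pi.
Qed.
Let oppE x : opp (pi x) = pi (- x).
Proof.
apply/quotient_projP; rewrite -opprD -[- (_ - x)]scaleN1r.
by apply: submodZ _ (submoduleP N) _; exact: repr_pi.
Qed.
Let scaleE a x : scale a (pi x) = pi (a *: x).
Proof.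
by apply/quotient_projP; rewrite -scalerBr; apply: submodZ _ (submoduleP N) _; exact: repr_pi.
Qed.

Let addA : associative add.
Proof. by move=> x y z; rewrite -(piK x) -(piK y) -(piK z) !addE addrA. Qed.
Let addC : commutative add.
Proof. by move=> x y; rewrite -(piK x) -(piK y) !addE addrC. Qed.
Let add0 : left_id (pi 0) add.
Proof. by move=> x; rewrite -(piK x) addE add0r. Qed.
Let addN : left_inverse (pi 0) opp add.
Proof. by move=> x; rewrite -(piK x) oppE addE addNr. Qed.

HB.instance Definition _ :=
  GRing.isZmodule.Build quotient_module addA addC add0 addN.

Let scaleA a b x : scale a (scale b x) = scale (a * b) x.
Proof. by rewrite -(piK x) !scaleE scalerA. Qed.
Let scale1 : left_id 1 scale.
Proof. by move=> x; rewrite -(piK x) scaleE scale1r. Qed.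
Let scaleDr : right_distributive scale +%R.
Proof.
move=> a x y; rewrite -(piK x) -(piK y) -[LHS]/(scale a (add _ _)).
by rewrite -[RHS]/(add _ _) addE !scaleE addE scalerDr.
Qed.
Let scaleDl x : {morph scale^~ x : a b / a + b}.
Proof.
by move=> a b; rewrite -(piK x) -[RHS]/(add _ _) !scaleE addE scalerDl.
Qed.

HB.instance Definition _ :=
  GRing.Zmodule_isLmodule.Build R quotient_module scaleA scale1 scaleDr scaleDl.

Lemma quotient_proj_linear : linear quotient_proj.
Proof. by move=> a x y; rewrite -[RHS]/(add (scale a (pi x)) (pi y)) scaleE addE. Qed.

Lemma quotient_proj_eq0 x : quotient_proj x = 0 <-> (N : set M) x.
Proof. by rewrite -[0]/(pi 0) quotient_projP subr0. Qed.

End Quotient.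

Section Flat.
Variable R : comNzRingType.

(** [t] factors through the span of the pure tensors. The induced map into the span, followed by the
    inclusion, is the identity by uniqueness. *)
Lemma is_tensor_span (M N T : lmodType R) (t : {bilinear M -> N -> T}) :
  is_tensor t -> forall u : T, generated [set t x y | x in setT & y in setT] u.
Proof.
move=> tT; pose S := Submodule (generated_submodule [set t x y | x in setT & y in setT]).
have St x y : t x y \in (S : set T).
  by apply: mem_set; apply: sub_gen_smallest; exists x => //; exists y.
pose b x y : submod S := exist _ (t x y) (St x y).
have [b' b'E] : exists b' : {bilinear M -> N -> submod S}, forall x y, b' x y = b x y.
  apply: bilinear_bundle => [y a u v|x a u v]; apply: val_inj; rewrite /=.
    by rewrite linearPl.
  by rewrite linearPr.
have [g [gE _]] := tT _ b'; have [h [_ hu]] := tT _ t.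
have vl : linear (fun u : T => val (g u)) by move=> a x y; rewrite !linearP.
have [v vE] := linear_bundle vl; have [i iE] := @linear_bundle R T T id (fun a x y => erefl).
move=> u; have -> : u = val (g u).
  rewrite -vE (hu v) => [|x y]; last by rewrite vE gE b'E.
  by rewrite -(hu i) ?iE // => x y; rewrite iE.
exact/set_mem/(valP (g u)).
Qed.

Lemma is_tensor_sum (M N T : lmodType R) (t : {bilinear M -> N -> T}) (u : T) :
  is_tensor t -> exists n (x : 'I_n -> M) (y : 'I_n -> N), u = \sum_i t (x i) (y i).
Proof.
move=> tT; apply: (generated_ind (B := [set u | exists n (x : 'I_n -> M)
  (y : 'I_n -> N), u = \sum_i t (x i) (y i)])) (is_tensor_span tT u).
  split=> [|a _ _ [n [x [y ->]]] [m [x' [y' ->]]]].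
    by exists 0, (fun=> 0), (fun=> 0); rewrite big_ord0.
  exists (n + m)%N,
    (fun i => match fintype.split i with inl j => a *: x j | inr k => x' k end),
    (fun i => match fintype.split i with inl j => y j | inr k => y' k end).
  rewrite big_split_ord scaler_sumr; congr (_ + _); apply: eq_bigr => i _.
    by rewrite (unsplitK (inl i : 'I_n + 'I_m)) linearZl_LR.
  by rewrite (unsplitK (inr i : 'I_n + 'I_m)).
by move=> _ [x _ [y _ <-]]; exists 1%N, (fun=> x), (fun=> y); rewrite big_ord1.
Qed.

(** Flatness is applied to the inclusion of [R r] in [R]: the tensor of [x] and [r] vanishes over
    [R], hence already over [R r]. Sending the tensor of [m] and [c r] to the class of [c m] modulo
    [(0 : r) M] is well defined and shows that the class of [x] is zero. *)
Lemma flat_annihilator (M : lmodType R) (r : R) (x : M) : flat M -> r *: x = 0 ->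
  ideal_mul [set s : R | s * r = 0] M x.
Proof.
move=> flM rx0.
pose A := Rideal r; pose r' : submod A := exist _ (r : R^o) (mem_set (divides_refl r)).
have [f fE] := @linear_bundle R (submod A) R^o val (fun a x y => erefl).
have [TA [tA tAT]] := tensor_exists M (submod A).
have [TB [tB tBT]] := tensor_exists M R^o.
have [b bE] : exists b : {bilinear M -> submod A -> TB}, forall x y, b x y = tB x (f y).
  apply: bilinear_bundle => [y a u v|m a u v]; first by rewrite linearPl.
  by rewrite linearP linearPr.
have [g [gE _]] := tAT _ b.
have tx0 : tA x r' = 0.
  apply: (flM _ _ f _ _ _ _ _ tAT tBT g).
  - by move=> u v; rewrite !fE => /val_inj.
  - by move=> m a; rewrite gE bE.
  rewrite gE bE fE linear0 /= -[r in LHS]mulr1 -[r * 1]/(r *: (1 : R^o)).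
  by rewrite linearZr_LR -linearZl_LR rx0 linear0l.
pose N : submodule M := Submodule (generated_submodule
  [set a *: x | a in [set s : R | s * r = 0] & x in [set: M]]).
pose c (a : submod A) := projT1 (cid (set_mem (valP a) : divides r (val a))).
have cE a : val a = c a * r by rewrite /c; case: cid.
pose p := quotient_proj N.
have pN a m : a * r = 0 -> p (a *: m) = 0.
  by move=> ar; apply/quotient_proj_eq0; apply: sub_gen_smallest; exists a => //; exists m.
have [q qE] := linear_bundle (@quotient_proj_linear R M N).
have [d dE] : exists d : {bilinear M -> submod A -> quotient_module N},
    forall m a, d m a = q (c a *: m).
  apply: bilinear_bundle => [y a u v|m a u v].
    by rewrite scalerDr linearD scalerA mulrC -scalerA linearZ.
  apply/eqP; rewrite -linearZ -linearD -subr_eq0 -linearB scalerA -scalerDl -scalerBl.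
  rewrite qE; apply/eqP/pN; rewrite mulrBl mulrDl -mulrA -!cE; exact: subrr.
have [h [hE _]] := tAT _ d.
have : q (c r' *: x) = 0 by rewrite -dE -hE tx0 linear0.
have : p ((1 - c r') *: x) = 0 by apply: pN; rewrite mulrBl -cE mul1r; exact: subrr.
rewrite /p -qE => E1 E2; have : q x = 0.
  by rewrite -[x]scale1r -(subrK (c r') 1) scalerDl linearD E1 E2 addr0.
by rewrite qE => /quotient_proj_eq0.
Qed.

(** A dual basis rewrites any tensor as a sum of tensors of [y j] and [c j]. From its image, the
    bilinear map sending [(z, b)] to [F j z *: b] recovers [f (c j)]; if the image is zero, so is
    each [c j]. *)
Lemma dual_basis_flat (M : lmodType R) :
  (forall n (x : 'I_n -> M), exists m (y : 'I_m -> M) (f : 'I_m -> {linear M -> R^o}),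
    (forall i j, f i (y j) = (i == j)%:R) /\
    forall k, x k = \sum_i f i (x k) *: y i) -> flat M.
Proof.
move=> dbM A B f injf TA TB tA tB tAT tBT g gE.
suff g0 u : g u = 0 -> u = 0.
  by move=> u v E; apply/eqP; rewrite -subr_eq0; apply/eqP/g0; rewrite linearB E subrr.
have [n [x [a ->]]] := is_tensor_sum u tAT; have [m [y [F [Fy xE]]]] := dbM n x.
have [c ->] : exists c, \sum_i tA (x i) (a i) = \sum_j tA (y j) (c j).
  exists (fun j => \sum_i F j (x i) *: a i).
  under eq_bigr => i _ do rewrite (xE i) linear_sumlz.
  rewrite exchange_big; apply: eq_bigr => j _; rewrite linear_sumr.
  by apply: eq_bigr => i _; rewrite linearZl_LR linearZr_LR.
rewrite linear_sum => E; apply: big1 => j _.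
suff -> : c j = 0 by rewrite linear0r.
have [e eE] : exists e : {bilinear M -> B -> B}, forall z b, e z b = F j z *: b.
  apply: bilinear_bundle => [b e v w|z e v w]; first by rewrite linearP scalerDl scalerA.
  by rewrite scalerDr !scalerA mulrC.
have [h [hE _]] := tBT _ e.
apply: injf; rewrite linear0; have := congr1 h E.
rewrite linear0 linear_sum (bigD1 j) //= gE hE eE Fy eqxx scale1r.
rewrite big1 ?addr0 // => k /negbTE kj.
by rewrite gE hE eE Fy eq_sym kj scale0r.
Qed.

End Flat.

(** * Nilpotency of the maximal ideal and syzygies *)

Section MaximalRings.
Variables (R : comNzRingType) (P : ideal R).
Hypotheses (val_R : valuation_ring R) (max_P : maximal_ideal P).
Implicit Types (a b p q r s t u x y z : R).

Section Nilpotency.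
Hypothesis PZ : forall p, (P : set R) p -> exists2 x, x <> 0 & p * x = 0.
Hypothesis intR : principal_intersections R.

(** Otherwise let [R b] be the intersection of the [R p^n], and write [b = p b']. Either [b'] lies
    in [R b] and vanishes, or some [p^n] is a multiple of [b']; then [p^(n+1)] is a multiple of [b],
    thus of [p^(n+2)], and vanishes, which is absurd. So [b = 0]; but a nonzero [x] with [p x = 0]
    lies in every [R p^n]. *)
Lemma P_nilpotent p : (P : set R) p -> exists n, p ^+ n = 0.
Proof.
move=> Pp; apply: contrapT => h.
have {}h n : p ^+ n <> 0 by move=> pn; apply: h; exists n.
have [|b bP] := intR (S := range (fun n => p ^+ n)); first by exists (p ^+ 0), 0%N.
have {}bP x : (forall n, divides (p ^+ n) x) <-> divides b x.
  rewrite -bP; split=> [hx _ [n _ <-]|hx n]; first exact: hx.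
  by apply: hx; exists n.
have pb n : divides (p ^+ n) b by apply: (bP b).2 (divides_refl b) n.
have b0 : b = 0.
  have [b' bE] := pb 1%N; rewrite expr1 mulrC in bE.
  case: (pselect (forall n, divides (p ^+ n) b')) => [/bP|/existsNP [n npb']].
    by rewrite {1}bE => /(divides_mulP val_R max_P Pp) b'0; rewrite bE b'0 mulr0.
  have [//|[s pnE]] := divides_total val_R (p ^+ n) b'.
  case: (h n.+1); apply: (divides_mulP val_R max_P Pp).
  rewrite -exprS; apply: (divides_trans (pb n.+2)); exists s.
  by rewrite exprS pnE bE mulrCA.
have [x nx px] := PZ Pp; apply: nx.
suff : divides b x by rewrite b0 => -[r ->]; rewrite mulr0.
apply/bP => n; have [//|[s pnE]] := divides_total val_R (p ^+ n) x.
by case: (h n.+1); rewrite exprS pnE mulrCA px mulr0.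
Qed.

(** The sequence starts at some [p0 <> 0], and the square of [q n.+1] divides [q n]. If no [q n]
    divides [p], then [p] divides them all, hence every power of [p] divides [q 0], which nilpotency
    makes zero. *)
Lemma P_countably_generated : ~ is_principal_ideal P ->
  exists2 q : nat -> R, forall n, (P : set R) (q n) &
    forall p, (P : set R) p -> exists n, divides (q n) p.
Proof.
move=> nP; have [p0 Pp0 np0] : exists2 p0, (P : set R) p0 & p0 <> 0.
  apply: contrapT => h; apply: nP; exists 0; apply/seteqP; split=> p.
    by move=> Pp; exists 0 => //; rewrite mul0r; apply: contrapT => np;
      apply: h; exists p => // p0; exact: np.
  by move=> [r _ <-]; rewrite mulr0; case: (submoduleP P).
have root p : exists q, (P : set R) p -> (P : set R) q /\ divides (q * q) p.
  case: (pselect ((P : set R) p)) => [Pp|]; last by exists 0.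
  have [q [r [Pq Pr ->]]] := P_notprincipal val_R max_P nP Pp.
  have [[s ->]|[s ->]] := divides_total val_R q r.
    by exists q; split=> //; exists s; rewrite mulrCA.
  by exists r; split=> //; exists s; rewrite mulrA.
pose f p := projT1 (cid (root p)).
have fP p : (P : set R) p -> (P : set R) (f p) /\ divides (f p * f p) p.
  by rewrite /f; case: cid.
pose q n := iter n f p0; have Pq n : (P : set R) (q n).
  by elim: n => //= n /fP [].
exists q => // p Pp; apply: contrapT => h.
have pq n : divides p (q n).
  by have [//|qp] := divides_total val_R p (q n); case: h; exists n.
have {}pq k n : divides (p ^+ k.+1) (q n).
  elim: k n => [|k IH] n; first by rewrite expr1.
  have [_ qq] := fP _ (Pq n); apply: divides_trans qq.
  have [s sE] := pq n.+1; have [t tE] := IH n.+1.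
  by rewrite -[f _]/(q n.+1) {1}sE tE; exists (s * t); rewrite [in RHS]exprS; ring.
have [n pn] := P_nilpotent Pp; have [s] := pq n 0%N.
by rewrite exprS pn !mulr0.
Qed.

End Nilpotency.

Section Syzygies.
Hypothesis annR : principal_annihilators R.

Lemma col_kernel n (c : 'cV[R]_n) : exists B : 'M[R]_n,
  forall v : 'rV[R]_n, v *m c = 0 <-> exists w : 'rV[R]_n, v = w *m B.
Proof.
case: n c => [|n] c.
  exists 0 => v; rewrite [v]thinmx0 mul0mx; split=> // _.
  by exists 0; rewrite mul0mx.
have [i imin] := divides_min_ord val_R (fun j => c j 0).
have [b bP] := annR [set c i 0].
pose d j := if j == i then 1 else projT1 (cid (imin j)).
have dE j : c j 0 = d j * c i 0.
  by rewrite /d; case: eqP => [->|_]; [rewrite mul1r|case: cid].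
have di : d i = 1 by rewrite /d eqxx.
(* Row [i] is [b e_i], where [b] generates the annihilator of the entry dividing all others; row [j]
   is [e_j - d_j e_i]. *)
pose B : 'M[R]_n.+1 := \matrix_(j, k)
  (if j == i then b * (k == i)%:R else (k == j)%:R - d j * (k == i)%:R).
have vc (v : 'rV_n.+1) : (v *m c) 0 0 = (\sum_j v 0 j * d j) * c i 0.
  rewrite mxE mulr_suml; apply: eq_bigr => j _.
  by rewrite -mulrA -dE.
have wB (w : 'rV_n.+1) k : (w *m B) 0 k =
    if k == i then w 0 i * b - \sum_(j | j != i) w 0 j * d j else w 0 k.
  rewrite mxE (bigD1 i) //= mxE eqxx; case: eqP => [->|/eqP ki].
    rewrite mulr1n mulr1 -sumrN; congr (_ + _); apply: eq_bigr => j /negbTE ji.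
    by rewrite mxE ji eqxx eq_sym ji mulr0n mulr1n sub0r mulr1 mulrN.
  rewrite mulr0n !mulr0 add0r (bigD1 k) //= mxE (negbTE ki) eqxx.
  rewrite mulr0n mulr1n mulr0 subr0 mulr1.
  rewrite big1 ?addr0 // => j /andP[/negbTE ji /negbTE jk].
  by rewrite mxE ji (negbTE ki) eq_sym jk mulr0n mulr0 subr0 mulr0.
exists B => v; split=> [vc0|[w ->]].
  have : (v *m c) 0 0 = 0 by rewrite vc0 mxE.
  rewrite vc => vd0; have [t tE] : divides b (\sum_j v 0 j * d j).
    by apply: (bP _).1 => _ ->.
  exists (\row_k (if k == i then t else v 0 k)); apply/rowP => k.
  rewrite wB !mxE eqxx; case: eqP => [->|//]; rewrite -tE (bigD1 i) //= di mulr1.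
  apply/eqP; rewrite eq_sym subr_eq; apply/eqP; congr (_ + _).
  by apply: eq_bigr => j /negbTE ji; rewrite mxE ji.
apply/matrixP => i0 j0; rewrite !ord1 vc [in RHS]mxE (bigD1 i) //= di mulr1 wB eqxx.
rewrite [X in _ + X](eq_bigr (fun j => w 0 j * d j)) ?subrK => [|j /negbTE ji];
  last by rewrite wB ji.
by rewrite -mulrA; have -> := (bP b).2 (divides_refl b) _ erefl; rewrite mulr0.
Qed.

(** Induction on the columns: [B1] parametrizes the kernel of the first one, and the others are
    pulled back along [B1]. *)
Lemma matrix_kernel n m (C : 'M[R]_(n, m)) : exists B : 'M[R]_n,
  forall v : 'rV[R]_n, v *m C = 0 <-> exists w : 'rV[R]_n, v = w *m B.
Proof.
elim: m C => [|m IH] C.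
  exists 1%:M => v; split=> [_|_]; first by exists v; rewrite mulmx1.
  by apply/matrixP => i [[]].
have [B1 B1P] := col_kernel (@lsubmx _ n 1 m C).
have [B2 B2P] := IH (B1 *m @rsubmx _ n 1 m C).
exists (B2 *m B1) => v.
have CE : v *m C = row_mx (v *m @lsubmx _ n 1 m C) (v *m @rsubmx _ n 1 m C).
  by rewrite -mul_mx_row hsubmxK.
rewrite CE; split=> [E|[w ->]].
  have /eq_row_mx [/B1P [w ->]] :
    row_mx (v *m @lsubmx _ n 1 m C) (v *m @rsubmx _ n 1 m C) = row_mx 0 0 :> 'rV_(1 + m).
    by rewrite E row_mx0.
  by rewrite -mulmxA => /B2P [w' ->]; exists w'; rewrite mulmxA.
have -> : w *m (B2 *m B1) *m @rsubmx _ n 1 m C = 0.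
  by rewrite mulmxA -mulmxA; apply/B2P; exists w.
have -> : w *m (B2 *m B1) *m @lsubmx _ n 1 m C = 0.
  by apply/B1P; exists (w *m B2); rewrite mulmxA.
exact: (@row_mx0 _ 1 1 m).
Qed.

Lemma trace_syzygies (M : lmodType R) n (x : 'I_n -> M) : trace_module M ->
  exists B : 'M[R]_n, forall v : 'rV[R]_n,
    \sum_i v 0 i *: x i = 0 <-> exists w : 'rV[R]_n, v = w *m B.
Proof.
move=> trM; have [m [y [f [fy xE]]]] := trace_dual_basis_ord val_R max_P x trM.
have [B BP] := matrix_kernel (\matrix_(i, j) (f j (x i) : R)).
exists B => v; rewrite -BP; split=> [vx|vC].
  apply/rowP => j; rewrite !mxE; have := congr1 (f j) vx.
  rewrite linear0 linear_sum => E; rewrite -[RHS]E; apply: eq_bigr => i _.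
  by rewrite mxE linearZ.
under eq_bigr => i _ do rewrite (xE i) scaler_sumr.
rewrite exchange_big big1 // => j _.
under eq_bigr => i _ do rewrite scalerA.
rewrite -scaler_suml (_ : \sum_i _ = (v *m (\matrix_(i, j) (f j (x i) : R))) 0 j).
  by rewrite vC mxE scale0r.
by rewrite mxE; apply: eq_bigr => i _; rewrite mxE.
Qed.

Lemma rows_fin_gen n (B : 'M[R]_n) :
  fin_gen [set v : 'rV[R]_n | exists w : 'rV[R]_n, v = w *m B].
Proof.
apply/fin_genP; exists n, (fun i => row i B); apply/seteqP; split=> v /= [w ->].
  by exists (fun i => w 0 i); rewrite mulmx_sum_row.
exists (\row_i w i); rewrite mulmx_sum_row; apply: eq_bigr => i _.
by rewrite mxE.
Qed.

Lemma trace_pi_coherent :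
  (forall I : Type, trace_module (module_power R I)) -> pi_coherent R.
Proof.
move=> trRI I N /fin_genP [n [x NE]].
have [B BP] := trace_syzygies x (trRI I).
have Nx (v : 'rV[R]_n) : \sum_i v 0 i *: x i \in (N : set (module_power R I)).
  by apply: mem_set; rewrite NE; exists (fun i => v 0 i).
pose f (v : 'rV[R]_n) : submod N := exist _ (\sum_i v 0 i *: x i) (Nx v).
have lf : linear f.
  move=> a u v; apply: val_inj; rewrite /= scaler_sumr -big_split.
  by apply: eq_bigr => i _; rewrite !mxE scalerDl scalerA.
have [g gE] := linear_bundle lf; exists n, g; split.
  have NP (u : module_power R I) : (N : set _) u ->
      exists c : 'I_n -> R, u = \sum_i c i *: x i.
    by rewrite NE.
  apply/seteqP; split=> // u _; have [c uE] := NP _ (set_mem (valP u)).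
  exists (\row_i c i) => //; rewrite gE; apply: val_inj; rewrite /= uE.
  by apply: eq_bigr => i _; rewrite mxE.
suff -> : g @^-1` [set 0] = [set v | exists w, v = w *m B] by exact: rows_fin_gen.
apply/seteqP; split=> v /=.
  by rewrite gE => /(congr1 val) /= /BP.
by move=> /BP E; rewrite gE; apply: val_inj.
Qed.

Lemma linear_extension (C : lmodType R) n (x : 'I_n -> C) (w : 'I_n -> R) :
  (forall c : C, exists v : 'rV[R]_n, c = \sum_i v 0 i *: x i) ->
  (forall v : 'rV[R]_n, \sum_i v 0 i *: x i = 0 -> \sum_i v 0 i * w i = 0) ->
  exists f : {linear C -> R^o}, forall v : 'rV[R]_n,
    f (\sum_i v 0 i *: x i) = \sum_i v 0 i * w i.
Proof.
move=> genx relw; pose k c := projT1 (cid (genx c)).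
have kE c : \sum_i k c 0 i *: x i = c by rewrite /k; case: cid.
have eqw (v v' : 'rV[R]_n) : \sum_i v 0 i *: x i = \sum_i v' 0 i *: x i ->
    \sum_i v 0 i * w i = \sum_i v' 0 i * w i.
  move=> E; apply/eqP; rewrite -subr_eq0 -sumrB.
  under eq_bigr => i _ do rewrite -mulrBl.
  apply/eqP; rewrite -[RHS](relw (v - v')); first by apply: eq_bigr => i _; rewrite !mxE.
  under eq_bigr => i _ do rewrite !mxE scalerBl.
  by rewrite sumrB E subrr.
have lf : linear (fun c => \sum_i k c 0 i * w i : R^o).
  move=> a c c'; rewrite regularZE mulr_sumr -big_split /=.
  rewrite (eqw _ (a *: k c + k c')) ?kE.
    by apply: eq_bigr => i _; rewrite !mxE mulrDl mulrA.
  under eq_bigr => i _ do rewrite !mxE scalerDl -scalerA.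
  by rewrite big_split -scaler_sumr !kE.
have [f fE] := linear_bundle lf; exists f => v; rewrite fE; apply: eqw.
by rewrite kE.
Qed.

Lemma trace_dual_fin_gen :
  (forall I : Type, trace_module (module_power R I)) ->
  forall C : lmodType R, fin_gen [set: C] -> fin_gen (dual_module C).
Proof.
move=> trRI C /fin_genP [n [x CE]].
have genx (c : C) : exists v : 'rV[R]_n, c = \sum_i v 0 i *: x i.
  have : [set: C] c by []; rewrite CE => -[v ->]; exists (\row_i v i).
  by apply: eq_bigr => i _; rewrite mxE.
(* The tuples [(f (x i))_i], for [f] in the dual, are the relations between the
   following elements of a power of [R]. *)
pose K := {v : 'rV[R]_n | \sum_i v 0 i *: x i == 0}.
have [B BP] := trace_syzygies (fun i => (fun v : K => val v 0 i) : module_power R K) (trRI K).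
have kerP (w : 'rV[R]_n) : (exists u : 'rV[R]_n, w = u *m B) <->
    (forall v : 'rV[R]_n, \sum_i v 0 i *: x i = 0 -> \sum_i v 0 i * w 0 i = 0).
  rewrite -BP; have evE (v : K) : (\sum_i w 0 i *: ((fun v : K => val v 0 i) :
      module_power R K)) v = \sum_i val v 0 i * w 0 i.
    pose ev (g : module_power R K) : R^o := g v.
    have [e eE] := @linear_bundle R (module_power R K) R^o ev (fun a g h => erefl).
    rewrite -[LHS]/(ev _) -eE linear_sum; apply: eq_bigr => i _.
    by rewrite linearZ eE; exact: mulrC.
  split=> [E v /eqP v0|E]; first by rewrite -(evE (exist _ v v0)) E.
  apply: functional_extensionality_dep => v; rewrite evE E //.
  exact/eqP/(valP v).
have F j : exists f : {linear C -> R^o}, forall v : 'rV[R]_n,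
    f (\sum_i v 0 i *: x i) = \sum_i v 0 i * B j i.
  apply: linear_extension => // v vx.
  have /kerP/(_ v vx) : exists u : 'rV[R]_n, row j B = u *m B.
    by exists (delta_mx 0 j); rewrite rowE.
  by under eq_bigr do rewrite mxE.
pose f j := projT1 (cid (F j)).
have fE j (v : 'rV[R]_n) : f j (\sum_i v 0 i *: x i) = \sum_i v 0 i * B j i.
  by rewrite /f; case: cid => g gE; exact: gE.
apply/fin_genP; exists n, (fun j => f j : C -> R^o); apply/seteqP; split=> g.
  move=> lg; have [g' g'E] := linear_bundle lg.
  have [|u uE] := (kerP (\row_i (g (x i) : R))).2.
    move=> v vx; transitivity (g' (\sum_i v 0 i *: x i)); last by rewrite vx linear0.
    by rewrite linear_sum; apply: eq_bigr => i _; rewrite mxE linearZ /= g'E.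
  exists (fun j => u 0 j); apply: funext => c; have [v ->] := genx c.
  transitivity (\sum_i v 0 i * (u *m B) 0 i).
    by rewrite -g'E linear_sum -uE; apply: eq_bigr => i _; rewrite mxE linearZ /= g'E.
  rewrite fct_sumE; under eq_bigr => i _ do rewrite mxE mulr_sumr.
  rewrite exchange_big; apply: eq_bigr => j _ /=.
  rewrite -[RHS]/(u 0 j * f j _) fE mulr_sumr; apply: eq_bigr => i _.
  by rewrite mulrCA.
move=> [c ->] a u v; rewrite !fct_sumE scaler_sumr -big_split.
apply: eq_bigr => j _ /=.
rewrite -[LHS]/(c j * f j _) -[RHS]/(a * (c j * f j _) + c j * f j _).
by rewrite linearP mulrDr mulrCA.
Qed.

End Syzygies.
End MaximalRings.

(** * Products of trace modules *)

Section Unimodular.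
Variables (R : comNzRingType) (P : ideal R).
Hypotheses (val_R : valuation_ring R) (max_P : maximal_ideal P).
Hypotheses (annR : principal_annihilators R) (dann : double_annihilator R).
Hypothesis injR : self_injective R.
Implicit Types (a b p q r s t u : R).

(** The map sending [r] to [r y] is injective; self-injectivity extends the identity of [R] along
    it. *)
Lemma faithful_unimodular (M : lmodType R) (y : M) :
  (forall r, r *: y = 0 -> r = 0) -> exists f : {linear M -> R^o}, f y = 1.
Proof.
move=> y0; have lg : linear (fun r : R^o => r *: y).
  by move=> a u v; rewrite scalerDl scalerA.
have [g gE] := linear_bundle lg.
have [|h hE] := injR (f := g) [the {linear R^o -> R^o} of idfun].
  move=> r s; rewrite !gE => /eqP; rewrite -subr_eq0 -scalerBl => /eqP /y0 /eqP.
  by rewrite subr_eq0 => /eqP.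
by exists h; have := hE 1; rewrite gE scale1r.
Qed.

Lemma ann_P r s : r <> 0 -> s * r = 0 -> (P : set R) s.
Proof. by move=> nr sr; apply: contrapT => nPs; apply: nr; exact: notin_reg nPs sr. Qed.

(** Write [x = a m] with [a] in the content ideal of [x <> 0]. If [r m = 0] with [r <> 0], flatness
    gives [m = s m'] with [s r = 0], so [s] is in [P]. Then [x] is in [s a M], so [s a] divides [a],
    and [a = 0]. Hence [m] is faithful, and a functional with value 1 at [m] takes the value [a] at
    [x]. *)
Lemma flat_content_trace (M : lmodType R) : flat_content M -> trace_module M.
Proof.
move=> [flM cM] x.
have [a ca [m xE]] := (ideal_mulP val_R _ (content_ideal_submodule x)).1 (cM x).
have [x0|/eqP nx] := eqVneq x 0.
  by exists \0, 0; rewrite scaler0.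
have [|f fm] := @faithful_unimodular M m; last first.
  by exists f, m; rewrite [in RHS]xE linearZ /= fm regularZE mulr1.
move=> r rm; apply: contrapT => nr; apply: nx.
have sA : is_submodule ([set s : R | s * r = 0] : set R^o).
  exact: (submoduleP (ann_ideal r)).
have [s sr [m' mE]] := (ideal_mulP val_R _ sA).1 (flat_annihilator flM rm).
suff a0 : a = 0 by rewrite xE a0 scale0r.
apply: (divides_mulP val_R max_P (ann_P nr sr)).
apply: (ca (Rideal (s * a))); apply/(ideal_mulP val_R _ (submoduleP _)).
exists (s * a); first exact: divides_refl.
by exists m'; rewrite mulrC -scalerA -mE.
Qed.

(* If [c] generates the intersection of the principal ideals containing all the
   [a_i = b_i c], then the [b_i] have zero annihilator: it would be contained
   in some [(0 : r) = R s] with [s] in [P], and [s c] would divide all [a_i]. *)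
Lemma trace_product (I : Type) (M : I -> lmodType R) :
  (forall i, trace_module (M i)) -> trace_module (module_product M).
Proof.
move=> trM x.
have [f fP] : exists f : forall i, {linear M i -> R^o},
    forall i, exists y, x i = f i (x i) *: y.
  exists (fun i => projT1 (cid (trM i (x i)))) => i.
  by case: cid.
have [z zE] : exists z : forall i, M i, forall i, x i = f i (x i) *: z i.
  by exists (fun i => projT1 (cid (fP i))) => i; case: cid.
pose a i : R := f i (x i).
have [|c cP] := double_annihilator_intersections dann annR
  (S := [set t | forall i, divides t (a i)]).
  by exists 1 => i; exists (a i); rewrite mulr1.
have ca i : divides c (a i) by apply: (cP _).1 => t; exact.
have [c0|/eqP nc] := eqVneq c 0.
  exists \0, 0; rewrite scaler0; apply: functional_extensionality_dep => i.
  by rewrite zE -/(a i); have [r ->] := ca i; rewrite c0 mulr0 scale0r.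
(* The value 0 where [a i = 0] matters: an arbitrary cofactor there need not be killed by the
   elements that kill [y]. *)
pose b i := if a i == 0 then 0 else projT1 (cid (ca i)).
have bE i : a i = b i * c.
  by rewrite /b; case: eqP => [->|_]; [rewrite mul0r|case: cid].
pose y : module_product M := fun i => b i *: z i.
have xE : x = c *: y.
  apply: functional_extensionality_dep => i.
  by rewrite zE -/(a i) bE mulrC -scalerA.
have [|g gy] := @faithful_unimodular _ y; last first.
  by exists g, y; rewrite [in RHS]xE linearZ /= gy regularZE mulr1.
move=> r ry; apply: contrapT => nr.
have rb i : r * b i = 0.
  (* Hence [f i (z i)] is a unit whenever [a i <> 0]. *)
  have ai : a i = f i (z i) * a i.
    by rewrite {1}/a zE linearZ mulrC.
  have := congr1 (fun h : module_product M => f i (h i)) ry.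
  rewrite -[(r *: y) i]/(r *: (b i *: z i)) -[(0 : module_product M) i]/(0 : M i).
  rewrite linear0 !linearZ /= !regularZE mulrA mulrC => rbz.
  have [ai0|/eqP nai] := eqVneq (a i) 0; first by rewrite /b; case: eqP => // _; exact: mulr0.
  apply: (notin_reg val_R max_P) rbz => Pfz.
  exact/nai/(mulP_fixed val_R max_P Pfz).
have [s sP] := annR [set r].
have sr : s * r = 0 := (sP s).2 (divides_refl s) r erefl.
apply: nc; apply: (divides_mulP val_R max_P (ann_P nr sr)).
apply: ((cP c).2 (divides_refl c)) => i.
have [t tE] : divides s (b i) by apply: (sP _).1 => _ ->; rewrite mulrC.
by exists t; rewrite bE tE mulrA.
Qed.

Lemma regular_trace : trace_module (R^o : lmodType R).
Proof.
have [f fE] := @linear_bundle R R^o R^o id (fun a x y => erefl).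
by move=> x; exists f, 1; rewrite fE regularZE mulr1.
Qed.

Lemma trace_sep_flat_content (M : lmodType R) : trace_module M -> sep_flat_content M.
Proof.
move=> trM; split; first exact: (trace_separable val_R max_P trM).
split; last exact: (trace_content val_R trM).
by apply: dual_basis_flat => n x; exact: (trace_dual_basis_ord val_R max_P x trM).
Qed.

End Unimodular.

(** * Coordinates in free modules and projectivity *)

Section FreeModule.
Variables (R : comNzRingType) (F : lmodType R).

Lemma generated_uniq_sum (B : set F) (x : F) : generated B x ->
  exists (s : seq F) (a : F -> R),
    [/\ uniq s, forall b, b \in s -> B b & x = \sum_(b <- s) a b *: b].
Proof.
apply: (generated_ind (B := [set x | exists (s : seq F) (a : F -> R),
  [/\ uniq s, forall b, b \in s -> B b & x = \sum_(b <- s) a b *: b]])).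
  split=> [|c _ _ [s [a [us sB ->]]] [s' [a' [us' s'B ->]]]].
    by exists [::], (fun=> 0); rewrite big_nil.
  exists (undup (s ++ s')), (fun b => (if b \in s then c * a b else 0) +
    (if b \in s' then a' b else 0)); split; first exact: undup_uniq.
    by move=> b; rewrite mem_undup mem_cat => /orP[/sB|/s'B].
  under [RHS]eq_bigr do rewrite scalerDl.
  rewrite big_split scaler_sumr /=.
  have sumE (t : seq F) (d : F -> R) : uniq t -> {subset t <= s ++ s'} ->
      \sum_(b <- t) d b *: b =
      \sum_(b <- undup (s ++ s')) (if b \in t then d b else 0) *: b.
    move=> ut tss'.
    rewrite [RHS](eq_bigr (fun b => if b \in t then d b *: b else 0)) => [|b _].
      rewrite -big_mkcond -big_filter; apply: perm_big.
      apply: uniq_perm => //; first by rewrite filter_uniq ?undup_uniq.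
      move=> b; rewrite mem_filter mem_undup.
      by case: (boolP (b \in t)) => //= /tss' ->.
    by case: ifP => // _; rewrite scale0r.
  congr (_ + _).
    under eq_bigr do rewrite scalerA.
    by apply: (sumE s (fun b => c * a b)) => // b bs; rewrite mem_cat bs.
  by apply: sumE => // b bs; rewrite mem_cat bs orbT.
move=> b Bb; exists [:: b], (fun=> 1); split=> //.
  by move=> b'; rewrite inE => /eqP ->.
by rewrite big_seq1 scale1r.
Qed.

(** By freeness there is exactly one scalar [k x] for which [x - k x *: b] lies in the span of the
    other basis elements. *)
Lemma basis_coordinate (B : set F) (b : F) : is_basis B -> B b ->
  exists f : {linear F -> R^o}, f b = 1 /\ forall b', B b' -> b' <> b -> f b' = 0.
Proof.
move=> [genB freeB] Bb; pose G := generated (B `\ b).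
have sG : is_submodule G by exact: generated_submodule.
have ex x : exists r : R, G (x - r *: b).
  have : generated B x by rewrite genB.
  apply: (generated_ind (B := [set x | exists r : R, G (x - r *: b)])).
    split=> [|a u v [r ru] [r' rv]].
      by exists 0; rewrite scale0r subr0; case: sG.
    exists (a * r + r'); have := submodD sG (submodZ a sG ru) rv.
    by rewrite scalerDl -scalerA scalerBr opprD addrACA.
  move=> b' Bb'; have [->|/eqP nb] := eqVneq b' b.
    by exists 1; rewrite scale1r subrr; case: sG.
  by exists 0; rewrite scale0r subr0; apply: sub_gen_smallest.
have Gb r : G (r *: b) -> r = 0.
  move=> /generated_uniq_sum [s [a [us sB rE]]].
  have nbs : b \notin s by apply/negP => /sB [_]; exact.
  apply: oppr_inj; rewrite oppr0.
  have := freeB (b :: s) (fun x => if x == b then - r else a x) _ _ _ b (mem_head _ _).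
  rewrite eqxx; apply; first by rewrite /= nbs.
    by move=> x; rewrite inE => /predU1P [->|/sB []].
  rewrite big_cons eqxx scaleNr rE addrC; apply/eqP; rewrite subr_eq0; apply/eqP.
  by apply: eq_big_seq => x xs; case: eqP => // xb; rewrite -xb xs in nbs.
pose k x := projT1 (cid (ex x)).
have kP x : G (x - k x *: b) by rewrite /k; case: cid.
have kuniq x r : G (x - r *: b) -> k x = r.
  move=> Gr; apply/eqP; rewrite -subr_eq0; apply/eqP/Gb.
  have := submodB sG Gr (kP x).
  by rewrite opprB addrC addrA subrK scalerBl.
have lk : linear (k : F -> R^o).
  move=> a u v; apply: kuniq; have := submodD sG (submodZ a sG (kP u)) (kP v).
  by rewrite regularZE scalerDl -scalerA scalerBr opprD addrACA.
have [f fE] := linear_bundle lk; exists f; split=> [|b' Bb' nb]; rewrite fE; apply: kuniq.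
  by rewrite scale1r subrr; case: sG.
by rewrite scale0r subr0; apply: sub_gen_smallest.
Qed.

End FreeModule.

Section Projective.
Variable R : comNzRingType.
Hypothesis val_R : valuation_ring R.

(** Among the finitely many coordinates of [phi x], one, [a b], divides the others. It is the value
    at [x] of the coordinate functional composed with [phi], and applying [pi] to [phi x] shows that
    [x] is a multiple of it. *)
Lemma locally_projective_trace (M : lmodType R) :
  locally_projective M -> trace_module M.
Proof.
move=> lpM x; have xN : fin_gen (generated [set x]).
  by exists [set x] => //; exact: finite_set1.
have [F [phi [pi [[B basB] piphi]]]] := lpM (Submodule (generated_submodule [set x])) xN.
have {}piphi : pi (phi x) = x by apply: piphi; exact: sub_gen_smallest.
have [|s [a [us sB phixE]]] := @generated_uniq_sum _ _ B (phi x).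
  by case: basB => ->.
have [s0|ns] := eqVneq s [::].
  by exists \0, 0; rewrite scaler0 -piphi phixE s0 big_nil linear0.
have [b bs bmin] := divides_min val_R a ns.
have [f [fb fb']] := basis_coordinate basB (sB _ bs).
have fphi : f (phi x) = a b.
  rewrite phixE linear_sum (bigD1_seq b) //= linearZ /= fb regularZE mulr1.
  rewrite big_seq_cond big1 ?addr0 // => b' /andP[b's /eqP nb].
  by rewrite linearZ /= (fb' b' (sB b' b's) nb) scaler0.
have lfphi : linear (fun u => f (phi u)) by move=> r u v; rewrite !linearP.
have [g gE] := linear_bundle lfphi.
have [c cE] : exists c : F -> R, forall b', b' \in s -> a b' = c b' * a b.
  have h b' : exists c, b' \in s -> a b' = c * a b.
    by case: (boolP (b' \in s)) => [/bmin [c ->]|_]; [exists c|exists 0].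
  by exists (fun b' => projT1 (cid (h b'))) => b'; case: cid.
exists g, (\sum_(b' <- s) c b' *: pi b'); rewrite gE fphi -[LHS]piphi phixE.
rewrite linear_sum scaler_sumr; apply: eq_big_seq => b' b's.
by rewrite linearZ scalerA (cE _ b's) mulrC.
Qed.

(* A coordinate of the image of [x] in a free module generates the ideal of
   coordinates. *)
Lemma singly_projective_coordinate (M : lmodType R) (x : M) :
  singly_projective M -> exists (a : R) (y : M), x = a *: y /\
    forall r : R, r *: x = 0 -> r * a = 0.
Proof.
move=> spM; pose N := Submodule (generated_submodule [set x]).
have [F [u [v [[B basB] vu]]]] := spM N (ex_intro _ x erefl).
have xN : x \in (N : set M) by apply: mem_set; exact: sub_gen_smallest.
pose x' : submod N := exist _ x xN.
have [|s [a [us sB uxE]]] := @generated_uniq_sum _ _ B (u x').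
  by case: basB => ->.
have xE : x = v (u x') by rewrite vu.
have [s0|ns] := eqVneq s [::].
  exists 0, 0; split=> [|r _]; last by rewrite mulr0.
  by rewrite scaler0 xE uxE s0 big_nil linear0.
have [b bs bmin] := divides_min val_R a ns.
have [c cE] : exists c : F -> R, forall b', b' \in s -> a b' = c b' * a b.
  have h b' : exists c, b' \in s -> a b' = c * a b.
    by case: (boolP (b' \in s)) => [/bmin [c ->]|_]; [exists c|exists 0].
  by exists (fun b' => projT1 (cid (h b'))) => b'; case: cid.
exists (a b), (\sum_(b' <- s) c b' *: v b'); split.
  rewrite [LHS]xE uxE linear_sum scaler_sumr; apply: eq_big_seq => b' b's.
  by rewrite linearZ scalerA (cE _ b's) mulrC.
move=> r rx; have rx' : r *: x' = 0 by apply: val_inj.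
case: basB => _ freeB; apply: (freeB s (fun b' => r * a b')) => //.
under eq_bigr do rewrite -scalerA.
by rewrite -scaler_sumr -uxE -linearZ rx' linear0.
Qed.

End Projective.

(** * Chains of cosets *)

(** A functional is built from its graph; linearity of the relation reduces single-valuedness to the
    fibre over 0. *)
Lemma linear_of_relation (R : comNzRingType) (M : lmodType R) (rho : M -> R -> Prop) :
  (forall x, exists r, rho x r) ->
  (forall a x y r s, rho x r -> rho y s -> rho (a *: x + y) (a * r + s)) ->
  (forall r, rho 0 r -> r = 0) ->
  exists f : {linear M -> R^o}, forall x r, rho x r -> f x = r.
Proof.
move=> tot lin rho0; pose k x := projT1 (cid (tot x)).
have kP x : rho x (k x) by rewrite /k; case: cid.
have kuniq x r : rho x r -> k x = r.
  move=> xr; have := lin (-1) _ _ _ _ xr (kP x).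
  rewrite scaleN1r addNr mulN1r addrC => /rho0 /eqP.
  by rewrite subr_eq0 => /eqP.
have lk : linear (k : M -> R^o) by move=> a x y; apply: kuniq; exact: lin.
by have [f fE] := linear_bundle lk; exists f => x r /kuniq <-; rewrite fE.
Qed.

(* The pair [(c, t)] stands for the coset [c + R t]: the cosets form a chain
   without a smallest element. *)
Definition coset_family (R : comNzRingType) (F : set (R * R)) :=
  [/\ F !=set0,
      forall p p', F p -> F p' -> divides p.2 p'.2 -> divides p.2 (p'.1 - p.1) &
      forall p, F p -> exists2 p', F p' & ~ divides p'.2 p.2].

(** The pairs [(u, q)] are the relations between two elements of the power [R^K], the families of
    all [k.1] and of all [k.2]. *)
Definition principal_relations (R : comNzRingType) :=
  forall K : set (R * R), exists g, forall q : R,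
    (exists u, forall k, K k -> u * k.1 + q * k.2 = 0) <-> divides g q.

(** In a valuation ring a nonzero combination of generators is divisible by one of them, so [x] is a
    generating family seen as an element of [R^I]. *)
Definition ideals_indexed_by (R : comNzRingType) (I : Type) :=
  forall A : ideal R, exists x : I -> R, (forall i, (A : set R) (x i)) /\
    forall a, (A : set R) a -> exists i, divides (x i) a.

Section Maximality.
Variables (R : comNzRingType) (P : ideal R).
Hypotheses (val_R : valuation_ring R) (max_P : maximal_ideal P).
Implicit Types (a b c q r s t u w : R) (F : set (R * R)).

(** If [L i] is smallest, [a i] lies in all cosets. Otherwise a principal ideal fits between [L i]
    and some strictly smaller [L j]. So the principal cosets containing some [a i + L i] form a
    family without smallest element, whose limits lie in all the given cosets. *)
Lemma maximal_ring_families :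
  (forall F, coset_family F ->
    exists w, forall p, F p -> divides p.2 (w - p.1)) -> maximal_ring R.
Proof.
move=> limF I a L fip.
have nest i j : L i `<=` L j -> (L j : set R) (a i - a j).
  move=> Lij; have [|z zP] := fip [set i; j]; first exact: finite_set2.
  have /ring_cosetP zi := zP i (or_introl erefl).
  have /ring_cosetP zj := zP j (or_intror erefl).
  rewrite (_ : a i - a j = (z - a j) - (z - a i)); last by ring.
  by apply: (submodB (M := R^o)) => //; [exact: submoduleP|exact: Lij].
have meet i j : exists z, (L i : set R) (z - a i) /\ (L j : set R) (z - a j).
  have [|z zP] := fip [set i; j]; first exact: finite_set2.
  by exists z; split; apply/ring_cosetP/zP; [left|right].
case: (pselect (exists i, forall j, L i `<=` L j)) => [[i imin]|nomin].
  by exists (a i) => j _; apply/ring_cosetP/nest.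
have {}nomin i : exists j x, [/\ (L i : set R) x, ~ (L j : set R) x & L j `<=` Rideal x].
  have [j nij] : exists j, ~ (L i `<=` L j).
    by apply/existsNP => h; apply: nomin; exists i.
  have [x Lix nLjx] : exists2 x, (L i : set R) x & ~ (L j : set R) x.
    apply: contrapT => h; apply: nij => x Lix; apply: contrapT => nLjx.
    by apply: h; exists x.
  by exists j, x; split=> // y Ljy; exact: divides_notin nLjx Ljy.
case: (pselect (inhabited I)) => [[i0]|noI]; last first.
  by exists 0 => i; case: noI.
pose F := [set p : R * R | exists i, divides p.2 (a i - p.1) /\ L i `<=` Rideal p.2].
have Fj j x : L j `<=` Rideal x -> F (a j, x).
  by move=> Ljx; exists j; split=> //=; rewrite subrr; exact: divides0.
have [|w wP] := limF F.
  split.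
  - by have [j [x [_ _ /Fj Fx]]] := nomin i0; exists (a j, x).
  - move=> p p' [i [ai Li]] [j [aj Lj]] pp'; have [z [zi zj]] := meet i j.
    rewrite (_ : p'.1 - p.1 =
      (a i - p.1) + (z - a i) - (z - a j) - (a j - p'.1)); last by ring.
    apply: dividesB; last exact: divides_trans aj.
    apply: dividesB; last exact: divides_trans pp' (Lj _ zj).
    by apply: dividesD => //; exact: Li.
  - move=> p [i [_ Li]]; have [j [x [Lix nLjx Ljx]]] := nomin i.
    have [k [y [Ljy nLky Lky]]] := nomin j.
    exists (a k, y); first exact: Fj.
    move=> yp; apply: nLjx; apply: ideal_divides Ljy _.
    exact: divides_trans yp (Li _ Lix).
exists w => i _; apply/ring_cosetP.
have [j [x [Lix nLjx Ljx]]] := nomin i.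
have Lji : L j `<=` L i by case: (val_R (L j) (L i)) => // /(_ _ Lix).
rewrite (_ : w - a i = (w - a j) + (a j - a i)); last by ring.
apply: (submodD (M := R^o)); [exact: submoduleP| |exact: nest].
exact: ideal_divides Lix (wP _ (Fj j x Ljx)).
Qed.

Hypothesis PZ : forall p, (P : set R) p -> exists2 x, x <> 0 & p * x = 0.
Hypothesis intR : principal_intersections R.

(** Otherwise each [q t] divides [b], and [(0 : q)] lies in every [R t], hence in [R b]. Write
    [b = q z_t t]: any two [z_t t] differ by an element of [(0 : q)], so they lie in every [R t],
    hence in [R b]. Thus [b] is a multiple of [q b] and vanishes, contradicting [(0 : q) <> 0]. *)
Lemma mulP_reaches_intersection (S : set R) b q : S !=set0 ->
  (forall x, (forall t, S t -> divides t x) <-> divides b x) ->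
  (P : set R) q -> exists2 t, S t & divides b (q * t).
Proof.
move=> [t0 St0] bP Pq; apply: contrapT => h.
have {}h t : S t -> ~ divides b (q * t) by move=> St bqt; apply: h; exists t.
have annq x : q * x = 0 -> divides b x.
  move=> qx; apply/bP => t St; have [//|[s tE]] := divides_total val_R t x.
  by case: (h t St); rewrite tE mulrCA qx mulr0; exact: divides0.
have [z zE] : divides (q * t0) b.
  by have [//|/(h t0 St0)] := divides_total val_R (q * t0) b.
have bqw : divides b (z * t0).
  apply/bP => t St; have [z' z'E] : divides (q * t) b.
    by have [//|/(h t St)] := divides_total val_R (q * t) b.
  rewrite -(subrK (z' * t) (z * t0)); apply: dividesD; last exact/dividesMl/divides_refl.
  apply: (bP _).2 St; apply: annq.
  by rewrite mulrBr mulrCA -zE mulrCA -z'E subrr.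
have b0 : b = 0.
  apply: (divides_mulP val_R max_P Pq); rewrite {2}zE mulrCA.
  by case: bqw => r ->; exists r; ring.
have [x nx qx] := PZ Pq; case: (annq x qx) => r xE.
by apply: nx; rewrite xE b0 mulr0.
Qed.

Lemma family_limit_mulP F q : coset_family F -> (P : set R) q ->
  exists w, forall p, F p -> divides p.2 (w - q * p.1).
Proof.
move=> [[p0 Fp0] nest _] Pq.
have [|b bP] := intR (S := [set p.2 | p in F]); first by exists p0.2, p0.
have [|_ [p Fp <-] bqp] := mulP_reaches_intersection _ bP Pq; first by exists p0.2, p0.
(* All the ideals of the family contain [q p.2], so below [p] the centres multiplied by [q] no
   longer move. *)
exists (q * p.1) => p' Fp'; rewrite -mulrBr.
have [p'p|pp'] := divides_total val_R p'.2 p.2.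
  by apply: dividesMl; exact: nest.
apply: (divides_trans ((bP b).2 (divides_refl b) _ _)); first by exists p'.
apply: (divides_trans bqp); have [r rE] := nest _ _ Fp Fp' pp'.
by exists (- r); rewrite -opprB rE; ring.
Qed.

(** If [P = R g], some [g p.2] lies in all ideals of the family. For [p1] strictly below [p], [p1.2]
    is in [P p.2 = R g p.2], hence in all of them, and nothing is strictly below [p1]. *)
Lemma family_nonprincipal F : coset_family F -> ~ is_principal_ideal P.
Proof.
move=> [[p0 Fp0] nest nomin] [g PE].
have Pg : (P : set R) g by rewrite PE; apply/principal_idealP/divides_refl.
have [|b bP] := intR (S := [set p.2 | p in F]); first by exists p0.2, p0.
have [|_ [p Fp <-] bgp] := mulP_reaches_intersection _ bP Pg; first by exists p0.2, p0.
have [p1 Fp1 np1] := nomin p Fp; have [p2 Fp2 np2] := nomin p1 Fp1.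
apply: np2; apply: (divides_trans ((bP b).2 (divides_refl b) _ _)); first by exists p2.
apply: (divides_trans bgp); have [s Ps ->] := divides_not val_R max_P np1.
have /principal_idealP [r ->] : principal_ideal g s by rewrite -PE.
by exists r; rewrite mulrA.
Qed.

Lemma functional_limit (I : Type) (q : module_power R I)
    (f : {linear module_power R I -> R^o}) :
  (forall i, (P : set R) (q i)) -> f q = 1 ->
  forall F, coset_family F -> exists w, forall p, F p -> divides p.2 (w - p.1).
Proof.
move=> Pq fq F famF.
have [z zP] : exists z : module_power R I,
    forall i p, F p -> divides p.2 (z i - q i * p.1).
  exists (fun i => projT1 (cid (family_limit_mulP famF (Pq i)))) => i.
  by case: cid.
exists (f z) => p Fp.
pose u : module_power R I := fun i => projT1 (cid (zP i p Fp)).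
have zE : z - p.1 *: q = p.2 *: u.
  apply: functional_extensionality_dep => i.
  rewrite -[LHS]/(z i - p.1 * q i) -[RHS]/(p.2 * u i) mulrC [RHS]mulrC.
  by rewrite /u; case: cid.
exists (f u); have := congr1 f zE; rewrite linearB !linearZ /= fq !regularZE mulrN1 => ->.
exact: mulrC.
Qed.

Lemma relations_limit : double_annihilator R -> principal_relations R ->
  forall F, coset_family F -> exists w, forall p, F p -> divides p.2 (w - p.1).
Proof.
move=> dann relR F famF.
(* [(-w, q)] is a relation for these pairs iff, for each coset [c + R t], every [r] in [(0 : t)]
   kills [w - q c]; by the double annihilator condition this means that [w] is a limit of the family
   multiplied by [q]. So [g] generates the ideal of the [q] for which such a limit exists. *)
have [g gP] := relR [set k | exists p r, [/\ F p, r * p.2 = 0 & k = (r, r * p.1)]].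
have gdiv q : (P : set R) q -> divides g q.
  move=> Pq; have [w wP] := family_limit_mulP famF Pq.
  apply/gP; exists (- w) => _ [p [r [Fp rp ->]]] /=.
  have [s sE] := wP p Fp.
  rewrite (_ : _ + _ = - (r * (w - q * p.1))); last by ring.
  by rewrite sE mulrCA rp mulr0 oppr0.
have nPg : ~ (P : set R) g.
  move=> Pg; apply: (family_nonprincipal famF); exists g; apply/seteqP.
  split=> x; first by move=> /gdiv ?; exact/principal_idealP.
  by move=> /principal_idealP; exact: ideal_divides.
have [h hg] := notin_unit val_R max_P nPg.
have /gP [u uP] : divides g 1 by exists h.
exists (- u) => p Fp; apply: dann => r rp.
have := uP (r, r * p.1) (ex_intro _ p (ex_intro _ r (And3 Fp rp erefl))).
rewrite /= => E; apply: oppr_inj; rewrite oppr0 -E; ring.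
Qed.

End Maximality.

(** * Functionals on separable powers *)

Section Separable.
Variables (R : comNzRingType) (P : ideal R).
Hypotheses (val_R : valuation_ring R) (max_P : maximal_ideal P).

(* A generating family of a faithful non-principal [P] does not belong to
   [P R^I], hence has a component outside [P R^I] in some uniserial summand,
   which is then free of rank one. *)
Lemma separable_functional (I : Type) (q : module_power R I) :
  separable_module (module_power R I) ->
  ~ is_principal_ideal P -> faithful_ideal P ->
  (forall i, (P : set R) (q i)) ->
  (forall p : R, (P : set R) p -> exists i, divides (q i) p) ->
  exists f : {linear module_power R I -> R^o}, f q = 1.
Proof.
set M := module_power R I; move=> sepM nP fP Pq genq.
have [|D [qD [E [DE DEt]] [n [U [uniU [sumU dirU]]]]]] := sepM [set q].
  exact: finite_set1.
have [v Uv vE] : exists2 v : 'I_n -> M, (forall i, (U i : set M) (v i)) & \sum_i v i = q.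
  have : (D : set M) q by exact: qD.
  by rewrite -sumU => -[v Uv <-]; exists v.
have [i nPv] : exists i, ~ ideal_mul P M (v i).
  apply/existsNP => Pv; apply: nP.
  have : ideal_mul P M q by rewrite -vE; exact: generated_sum.
  move=> /(ideal_mulP val_R _ (submoduleP P)) [p Pp [m qE]]; exists p.
  apply/seteqP; split=> x; last by move=> /principal_idealP; exact: ideal_divides.
  move=> /genq [j qx]; apply/principal_idealP; apply: divides_trans qx.
  by exists (m j); rewrite mulrC qE.
set u := v i in nPv.
(* Each [p] in [P] is divisible by some [u j], as otherwise [u] would lie in [p R^I]. So [r u = 0]
   gives [r P = 0]. *)
have u0 r : r *: u = 0 -> r = 0.
  move=> ru; apply: (faithfulP fP) => p Pp.
  have [j uj] : exists j, divides (u j) p.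
    apply: contrapT => h; apply: nPv; apply/(ideal_mulP val_R _ (submoduleP P)).
    exists p => //.
    have pu j : divides p (u j).
      by have [//|up] := divides_total val_R p (u j); case: h; exists j.
    exists (fun j => projT1 (cid (pu j))); apply: functional_extensionality_dep => j.
    by rewrite -[RHS]/(p * projT1 _) mulrC; case: cid.
  have rj : r * u j = 0 by exact: (congr1 (fun g : M => g j) ru).
  by case: uj => s ->; rewrite mulrCA rj mulr0.
have Ui x : (U i : set M) x -> exists r, x = r *: u.
  move=> Ux; pose x' : submod (U i) := exist _ x (mem_set Ux).
  pose u' : submod (U i) := exist _ u (mem_set (Uv i)).
  case: (uniU i (Submodule (line_submodule x')) (Submodule (line_submodule u'))) => h.
    have [|r /(congr1 val) /= xE] := h x'; first by exists 1; rewrite scale1r.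
    by exists r.
  have [|r /(congr1 val) /= uE] := h u'; first by exists 1; rewrite scale1r.
  have nPr : ~ (P : set R) r.
    move=> Pr; apply: nPv; apply/(ideal_mulP val_R _ (submoduleP P)).
    by exists r => //; exists x.
  have [s sr] := notin_unit val_R max_P nPr.
  by exists s; rewrite uE scalerA sr scale1r.
(* Graph of the projection onto [U i], read in the coordinate along [u]. *)
pose rho (x : M) (r : R) := exists (w : 'I_n -> M) (e : M),
  [/\ forall j, (U j : set M) (w j), (E : set M) e, x = \sum_j w j + e & w i = r *: u].
have [|a x y r s [w [e [Uw Ee xE wE]]] [w' [e' [Uw' Ee' yE w'E]]]|
      r [w [e [Uw Ee E0 wE]]]|f fP'] :=
  @linear_of_relation R M rho.
- move=> x; have : [set: M] x by []; rewrite -DEt => -[d Dd [e Ee <-]].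
  move: Dd; rewrite -sumU => -[w Uw <-]; have [r wE] := Ui _ (Uw i).
  by exists r, w, e.
- exists (fun j => a *: w j + w' j), (a *: e + e'); split.
  + by move=> j; case: (submoduleP (U j)) => _; apply; [exact: Uw|exact: Uw'].
  + by case: (submoduleP E) => _; exact.
  + by rewrite xE yE scalerDr big_split scaler_sumr /= addrACA.
  + by rewrite wE w'E scalerDl scalerA.
- have w0 : \sum_j w j = 0.
    have : (D `&` E) (\sum_j w j).
      split; first by rewrite -sumU; exists w.
      rewrite (_ : \sum_j w j = (-1) *: e).
        by apply: submodZ => //; exact: submoduleP.
      by apply/eqP; rewrite scaleN1r -addr_eq0 -E0.
    by rewrite DE.
  by apply: u0; rewrite -wE; exact: (dirU w Uw w0 i).
exists f; apply: fP'; exists v, 0; split=> //; first by case: (submoduleP E).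
  by rewrite addr0.
by rewrite scale1r.
Qed.

End Separable.

(** * Principal annihilators from powers of the ring *)

Section Coordinates.
Variable R : comNzRingType.
Hypothesis val_R : valuation_ring R.

(** If [r x = 0], flatness puts [x] in [(0 : r) M], so the content ideal, which contains [a], lies
    in [(0 : r)]. *)
Lemma flat_content_coordinate (M : lmodType R) (x : M) :
  flat_content M -> exists (a : R) (y : M), x = a *: y /\
    forall r : R, r *: x = 0 -> r * a = 0.
Proof.
move=> [flM cM].
have [a ca [y xE]] := (ideal_mulP val_R _ (content_ideal_submodule x)).1 (cM x).
exists a, y; split=> // r rx; rewrite mulrC.
exact: (ca (ann_ideal r) (flat_annihilator flM rx)).
Qed.

(** Let [x = a y] be a generating family of [(0 : S)]. Then [a] divides every [x i], and each
    element of [S] kills [x], hence [a]; so [(0 : S) = R a]. *)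
Lemma annihilators_of_coordinates (I : Type) : ideals_indexed_by R I ->
  (forall x : module_power R I, exists (a : R) (y : module_power R I),
     x = a *: y /\ forall r : R, r *: x = 0 -> r * a = 0) ->
  principal_annihilators R.
Proof.
move=> idI coord S.
have sA := annihilator_submodule S.
have [x [Ax xgen]] := idI (Submodule sA); have [a [y [xE xa]]] := coord x.
exists a => r; split=> [Sr|[t ->] s Ss].
  have [i xr] := xgen r Sr; apply: divides_trans xr.
  by exists (y i); rewrite mulrC xE.
rewrite -mulrA (mulrC a) xa ?mulr0 //; apply: functional_extensionality_dep => i.
by rewrite -[LHS]/(s * x i) mulrC; exact: Ax.
Qed.

Lemma ideals_indexed_by_self : ideals_indexed_by R R.
Proof.
move=> A; exists (fun r => if pselect ((A : set R) r) then r else 0); split=> [r|r Ar].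
  by case: pselect => //= ?; case: (submoduleP A).
by exists r; case: pselect => //= ?; exact: divides_refl.
Qed.

Lemma ideals_indexed_by_nat :
  (forall A : ideal R, countably_gen A) -> ideals_indexed_by R nat.
Proof.
move=> cg A; have [X cX AE] := cg A.
have XA x : X x -> (A : set R) x by move=> Xx; rewrite AE; exact: sub_gen_smallest.
have AX a : (A : set R) a -> a = 0 \/ exists2 x, X x & divides x a.
  rewrite AE; apply: (generated_ind
    (B := [set a : R^o | a = 0 \/ exists2 x, X x & divides x a])).
    move=> {a}; split=> [|r a b ha hb] /=; first by left.
    case: hb => [b0|[y Xy yb]].
      case: ha => [a0|[x Xx xa]]; first by left; rewrite a0 b0 scaler0 addr0.
      by right; exists x => //; rewrite b0 addr0; exact: dividesMl.
    right; case: ha => [a0|[x Xx xa]]; first by exists y; rewrite // a0 scaler0 add0r.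
    have [xy|yx] := divides_total val_R x y.
      by exists x => //; apply: dividesD; [exact: dividesMl|exact: divides_trans yb].
    by exists y => //; apply: dividesD; [apply: dividesMl; exact: divides_trans xa|].
  by move=> x Xx; right; exists x => //; exact: divides_refl.
have [g ginj] := countable_injP _ cX.
pose f n := if pselect (exists2 x, X x & g x = n) is left h then s2val (cid2 h) else 0.
have fX n : (A : set R) (f n).
  rewrite /f; case: pselect => [h|?] /=; last by case: (submoduleP A).
  by apply: XA; case: cid2.
exists f; split=> // a /AX [->|[x Xx xa]]; first by exists 0%N; exact: divides0.
exists (g x); suff -> : f (g x) = x by [].
rewrite /f; case: pselect => [h|[]] /=; last by exists x.
by case: cid2 => y Xy gyx /=; apply: ginj; rewrite ?inE.
Qed.

End Coordinates.

(** * Relations between generators *)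

Section Relations.
Variable R : comNzRingType.

(** On pairs [(0, s)] the relation reads [q s = 0], whatever [u] is. *)
Lemma principal_relations_annihilators :
  principal_relations R -> principal_annihilators R.
Proof.
move=> relR S; have [g gP] := relR [set k | k.1 = 0 /\ S k.2].
exists g => r; rewrite -gP; split=> [Sr|[u uP] a Sa].
  by exists 0 => -[k1 k2] [/= -> Sk]; rewrite mulr0 add0r Sr.
by have := uP (0, a) (conj erefl Sa); rewrite /= mulr0 add0r.
Qed.

Section FinitelyPresented.
Variables (N : lmodType R) (k : nat) (x : 'I_k -> N).

(* Schanuel's lemma: the relations between any finite family of generators of
   a finitely presented module are finitely generated. *)
Lemma fin_presented_relations : fin_presented N ->
  (forall y : N, exists c : 'rV[R]_k, y = \sum_i c 0 i *: x i) ->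
  exists m (B : 'M[R]_(m, k)), forall w : 'rV[R]_k,
    \sum_i w 0 i *: x i = 0 <-> exists c : 'rV[R]_m, w = c *m B.
Proof.
move=> [n [f [fsurj /fin_genP [l [g kerf]]]]] genx.
pose s m (y : 'I_m -> N) (w : 'rV[R]_m) := \sum_i w 0 i *: y i.
have sB m (y : 'I_m -> N) w w' : s m y (w - w') = s m y w - s m y w'.
  by rewrite /s -sumrB; apply: eq_bigr => i _; rewrite !mxE scalerBl.
have sD m (y : 'I_m -> N) w w' : s m y (w + w') = s m y w + s m y w'.
  by rewrite /s -big_split; apply: eq_bigr => i _; rewrite !mxE scalerDl.
have [A AP] : exists A : 'M[R]_(k, n), forall w, f (w *m A) = s k x w.
  have h i : exists v, f v = x i.
    have : range f (x i) by rewrite fsurj.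
    by move=> [v _ <-]; exists v.
  pose a i := projT1 (cid (h i)); have aE i : f (a i) = x i by rewrite /a; case: cid.
  exists (\matrix_(i, j) a i 0 j) => w.
  rewrite mulmx_sum_row linear_sum; apply: eq_bigr => i _; rewrite linearZ /=.
  by rewrite -aE; congr (_ *: f _); apply/rowP => j; rewrite !mxE.
have [B BP] : exists B : 'M[R]_(n, k), forall v, s k x (v *m B) = f v.
  pose b j := projT1 (cid (genx (f (delta_mx 0 j)))).
  have bE j : s k x (b j) = f (delta_mx 0 j) by rewrite /b; case: cid.
  exists (\matrix_(j, i) b j 0 i) => v.
  rewrite [in RHS](row_sum_delta v) linear_sum.
  under [RHS]eq_bigr => j _ do rewrite linearZ /= -bE /s scaler_sumr.
  rewrite exchange_big; apply: eq_bigr => i _; rewrite mxE scaler_suml.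
  by apply: eq_bigr => j _; rewrite mxE scalerA.
pose G : 'M[R]_(l, n) := \matrix_(i, j) g i 0 j.
have kerG v : f v = 0 <-> exists c : 'rV[R]_l, v = c *m G.
  have cG (c : 'rV_l) : c *m G = \sum_i c 0 i *: g i.
    rewrite mulmx_sum_row; apply: eq_bigr => i _; congr (_ *: _).
    by apply/rowP => j; rewrite !mxE.
  have -> : f v = 0 <-> (f @^-1` [set 0]) v by [].
  rewrite kerf; split=> [[c ->]|[c ->]]; last by exists (c 0); rewrite cG.
  by exists (\row_i c i); rewrite cG; apply: eq_bigr => i _; rewrite mxE.
(* A relation [w] splits as [w (1 - A B) + (w A) B], and [w A], being in the kernel of [f], is of
   the form [c G]. *)
exists (k + l)%N, (col_mx (1%:M - A *m B) (G *m B)) => w.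
rewrite -/(s k x w); split=> [w0|[c ->]].
  have [|c cE] := (kerG (w *m A)).1; first by rewrite AP.
  exists (row_mx w c).
  by rewrite mul_row_col mulmxBr mulmx1 !mulmxA -cE subrK.
rewrite -[c]hsubmxK mul_row_col mulmxBr mulmx1 !mulmxA sD sB !BP AP subrr add0r.
by apply/kerG; exists (rsubmx c).
Qed.

End FinitelyPresented.
End Relations.

Section SmallModules.
Variable R : comNzRingType.

Lemma span_members (M : lmodType R) n (X : 'I_n -> M) :
  exists x : 'I_n -> submod (Submodule (span_submodule X)),
    (forall i, val (x i) = X i) /\
    forall y, exists c : 'rV[R]_n, y = \sum_i c 0 i *: x i.
Proof.
have XN i : X i \in (Submodule (span_submodule X) : set M).
  apply: mem_set; exists (fun j => (j == i)%:R); rewrite (bigD1 i) //= eqxx scale1r.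
  by rewrite big1 ?addr0 // => j /negbTE ->; rewrite scale0r.
exists (fun i => exist _ (X i) (XN i)); split=> // y.
have [c yE] := set_mem (valP y); exists (\row_i c i).
apply: val_inj; rewrite yE linear_sum /=; apply: eq_bigr => i _.
by rewrite mxE.
Qed.

Lemma span_fin_gen (M : lmodType R) n (X : 'I_n -> M) :
  fin_gen (Submodule (span_submodule X) : set M).
Proof. by apply/fin_genP; exists n, X. Qed.

Definition pair_family (I : Type) (v : I -> R * R) : 'I_2 -> module_power R I :=
  fun i => if i == ord0 then (fun k => (v k).1) else (fun k => (v k).2).

Lemma pair_family_sum (I : Type) (v : I -> R * R) (w : 'rV[R]_2) (k : I) :
  (\sum_i w 0 i *: pair_family v i) k = w 0 ord0 * (v k).1 + w 0 ord_max * (v k).2.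
Proof.
rewrite big_ord_recl big_ord_recl big_ord0 addr0.
by rewrite (_ : lift ord0 ord0 = ord_max) //; apply: val_inj.
Qed.

Lemma row2 (u q : R) : exists w : 'rV[R]_2, w 0 ord0 = u /\ w 0 ord_max = q.
Proof.
by exists (\row_i if i == ord0 then u else q); rewrite !mxE.
Qed.

Hypothesis val_R : valuation_ring R.

(** The two coordinate families span a finitely presented submodule of [R^K]; the second coordinates
    of its relations form a finitely generated, hence principal, ideal. *)
Lemma pi_coherent_relations : pi_coherent R -> principal_relations R.
Proof.
move=> cohR K; pose I := {k : R * R | `[< K k >]}; pose v (i : I) := val i.
have [x [xE genx]] := span_members (pair_family v).
have [m [B BP]] := fin_presented_relations (cohR _ _ (span_fin_gen (pair_family v))) genx.
have relE (w : 'rV[R]_2) : \sum_i w 0 i *: x i = 0 <->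
    forall k, K k -> w 0 ord0 * k.1 + w 0 ord_max * k.2 = 0.
  have valE : val (\sum_i w 0 i *: x i) = \sum_i w 0 i *: pair_family v i.
    by rewrite linear_sum; apply: eq_bigr => i _; rewrite /= xE.
  split=> [E k /asboolP Kk|E].
    rewrite -(pair_family_sum v w (exist _ k Kk)) -valE E.
    by [].
  apply: val_inj; rewrite valE; apply: functional_extensionality_dep => i.
  by rewrite pair_family_sum E //; exact/asboolP/(valP i).
have [|g gE] := @fin_gen_ideal _ val_R
    [set q : R^o | exists c : 'I_m -> R, q = \sum_j c j *: (B j ord_max : R^o)].
  by apply/fin_genP; exists m, (fun j => B j ord_max).
exists g => q; rewrite -principal_idealP -gE; split=> [[u uq]|[c qE]].
  have [w [wu wq]] := row2 u q.
  have /BP [c wE] : \sum_i w 0 i *: x i = 0 by apply/relE => k Kk; rewrite wu wq uq.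
  by exists (c 0); rewrite -wq wE mxE.
have /relE rel : \sum_i (\row_j c j *m B) 0 i *: x i = 0 by apply/BP; exists (\row_j c j).
exists ((\row_j c j *m B) 0 ord0) => k /rel.
suff -> : (\row_j c j *m B) 0 ord_max = q by [].
by rewrite qE mxE; apply: eq_bigr => j _; rewrite mxE.
Qed.

(** [C] is spanned in [R^I] by the families of first and of second entries of the pairs orthogonal
    to [K]. Evaluation at [(u, q)] takes the value [q] on the second generator. Conversely, each [k]
    in [K] is a relation between the generators, so the values of a functional on them are
    orthogonal to [K]. The ideal sought is thus the set of values of the dual at the second
    generator. *)
Lemma fin_gen_dual_relations :
  (forall C : lmodType R, fin_gen [set: C] -> fin_gen (dual_module C)) ->
  principal_relations R.
Proof.
move=> dualR K.
pose I := {w : R * R | `[< forall k, K k -> w.1 * k.1 + w.2 * k.2 = 0 >]}.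
pose v (i : I) := val i; have [x [xE genx]] := span_members (pair_family v).
pose C : lmodType R := submod (Submodule (span_submodule (pair_family v))).
have [|n [f dE]] := (fin_genP _).1 (dualR C _).
  apply/fin_genP; exists 2, x; apply/seteqP; split=> // y _ /=.
  by have [c ->] := genx y; exists (c 0).
pose F j : C -> R^o := f j.
have [|g gE] := @fin_gen_ideal _ val_R
    [set q : R^o | exists c : 'I_n -> R, q = \sum_j c j *: F j (x ord_max)].
  by apply/fin_genP; exists n, (fun j => F j (x ord_max)).
exists g => q; rewrite -principal_idealP -gE; split=> [[u uq]|[c qE]].
  have Iuq : `[< forall k, K k -> (u, q).1 * k.1 + (u, q).2 * k.2 = 0 >] by apply/asboolP.
  have : dual_module C (fun y : C => (val y : module_power R I) (exist _ (u, q) Iuq) : R^o).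
    by [].
  rewrite dE => -[c /(congr1 (fun h => h (x ord_max))) E]; exists c.
  by move: E; rewrite xE fct_sumE.
pose h : C -> R^o := \sum_j c j *: f j.
have lh : linear h.
  suff : dual_module C h by [].
  by rewrite dE; exists c.
have hE : h (x ord_max) = q by rewrite /h fct_sumE qE.
have [h' h'E] := linear_bundle lh.
exists (h (x ord0)) => k Kk.
have [w [wk1 wk2]] := row2 k.1 k.2.
have rel : \sum_i w 0 i *: x i = 0.
  apply: val_inj; rewrite linear_sum /=; under eq_bigr => i _ do rewrite xE.
  apply: functional_extensionality_dep => i; rewrite pair_family_sum wk1 wk2.
  have := valP i => /asboolP /(_ k Kk); rewrite mulrC (mulrC (val i).2).
  by [].
have := congr1 h' rel; rewrite linear0 linear_sum big_ord_recl big_ord_recl big_ord0 addr0.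
rewrite (_ : lift ord0 ord0 = ord_max); last exact: val_inj.
by rewrite !linearZ /= !h'E wk1 wk2 hE !regularZE mulrC (mulrC k.2).
Qed.

End SmallModules.

(** * The equivalences *)

Section Equivalences.
Variables (R : comNzRingType) (P : ideal R).
Hypotheses (val_R : valuation_ring R) (max_P : maximal_ideal P).
Hypothesis Z_neq0 : zero_divisors R <> [set 0].

(** Condition (6), the hub of the equivalences. *)
Definition maximal_almost_principal :=
  [/\ maximal_ring R, is_principal_ideal P \/ faithful_ideal P &
      forall A : ideal R, exists a : R,
        A = principal_ideal a :> set R \/ A = ideal_mulr P a :> set R].

Section Annihilators.
Hypothesis annR : principal_annihilators R.

Let PZ := zero_divisors_max val_R max_P annR Z_neq0.

Lemma annihilators_double : double_annihilator R.
Proof. exact: PZ_double_annihilator val_R max_P PZ. Qed.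

Lemma annihilators_intersections : principal_intersections R.
Proof. exact: double_annihilator_intersections annihilators_double annR. Qed.

(** A coset family exists only if [P] is not principal, hence faithful; so limits are needed in that
    case only. *)
Lemma annihilators_maximal :
  (forall F : set (R * R), ~ is_principal_ideal P -> faithful_ideal P ->
     coset_family F -> exists w, forall p, F p -> divides p.2 (w - p.1)) ->
  maximal_almost_principal.
Proof.
move=> limF; have intR := annihilators_intersections.
have pfP := annihilators_P val_R max_P annR.
split=> //; last exact: intersections_ideals val_R max_P intR.
apply: maximal_ring_families val_R _ => F famF.
have nP := family_nonprincipal val_R max_P PZ intR famF.
by apply: limF => //; case: pfP.
Qed.

Lemma functional_maximal :
  (~ is_principal_ideal P -> faithful_ideal P ->
   exists (I : Type) (q : module_power R I) (f : {linear module_power R I -> R^o}),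
     (forall i, (P : set R) (q i)) /\ f q = 1) ->
  maximal_almost_principal.
Proof.
move=> h; apply: annihilators_maximal => F nP fP famF.
have [I [q [f [Pq fq]]]] := h nP fP.
exact: (functional_limit val_R max_P PZ annihilators_intersections Pq fq famF).
Qed.

Lemma separable_maximal (I : Type) : ideals_indexed_by R I ->
  separable_module (module_power R I) -> maximal_almost_principal.
Proof.
move=> idI sepI; apply: functional_maximal => nP fP; have [q [Pq genq]] := idI P.
have [f fq] := separable_functional val_R max_P sepI nP fP Pq genq.
by exists I, q, f.
Qed.

End Annihilators.

Lemma relations_maximal : principal_relations R -> maximal_almost_principal.
Proof.
move=> relR; have annR := principal_relations_annihilators relR.
apply: annihilators_maximal => // F _ _.
exact: relations_limit val_R max_P (zero_divisors_max val_R max_P annR Z_neq0)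
  (annihilators_intersections annR) (annihilators_double annR) relR F.
Qed.

Lemma flat_content_maximal (I : Type) : ideals_indexed_by R I ->
  sep_flat_content (module_power R I) -> maximal_almost_principal.
Proof.
move=> idI [sepI fcI]; apply: (separable_maximal _ idI sepI).
by apply: (annihilators_of_coordinates idI) => x; exact: flat_content_coordinate.
Qed.

Lemma singly_projective_maximal (I : Type) : ideals_indexed_by R I ->
  singly_projective (module_power R I) -> separable_module (module_power R I) ->
  maximal_almost_principal.
Proof.
move=> idI spI sepI; apply: (separable_maximal _ idI sepI).
by apply: (annihilators_of_coordinates idI) => x; exact: singly_projective_coordinate.
Qed.

Lemma injective_maximal :
  (forall A : ideal R, is_proper_ideal A -> fin_gen (annihilator_of A)) ->
  self_injective R -> maximal_almost_principal.
Proof.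
move=> annfg injR; have annR : principal_annihilators R.
  (* [S] is replaced by the ideal [(0 : (0 : S))], which has the same annihilator; if this ideal is
     [R], the annihilator is 0. *)
  move=> S; have sA : is_submodule
      ([set x : R | forall r, (forall s, S s -> r * s = 0) -> r * x = 0] : set R^o).
    split=> [r _|c x y Sx Sy r Sr]; first by rewrite mulr0.
    by rewrite mulrDr mulrCA Sx // Sy // mulr0 addr0.
  case: (pselect (is_proper_ideal (Submodule sA))) => [/annfg|/contrapT AT].
    move=> /(fin_gen_ideal val_R) [b bE]; exists b => r.
    rewrite -principal_idealP -bE; split=> [Sr x|Ar s Ss]; first exact.
    by apply: Ar => r'; exact.
  exists 0 => r; split=> [Sr|[t ->] s _]; last by rewrite mulr0 mul0r.
  have : (Submodule sA : set R) 1 by rewrite AT.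
  by move=> /(_ r Sr); rewrite mulr1 => ->; exact: divides0.
apply: functional_maximal => // nP fP.
exists {p : R | p \in (P : set R)}, (fun p => val p).
have [r r0|f fq] := @faithful_unimodular R injR
    (module_power R {p : R | p \in (P : set R)}) (fun p => val p).
  apply: (faithfulP fP) => p Pp.
  exact: (congr1 (fun g : module_power R _ => g (exist _ p (mem_set Pp))) r0).
by exists f; split=> // p; exact/set_mem/(valP p).
Qed.

Lemma intersections_maximal : maximal_ring R ->
  is_principal_ideal P \/ faithful_ideal P ->
  (forall (I : Type) (a : I -> R), [set: I] !=set0 ->
     fin_gen (\bigcap_i principal_ideal (a i) : set R^o)) ->
  maximal_almost_principal.
Proof.
move=> maxR pfP capR; split=> //; apply: (intersections_ideals val_R max_P) => S [t0 St0].
pose a (t : {t : R | `[< S t >]}) := val t.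
have [|b bE] := fin_gen_ideal val_R (capR _ a _).
  by exists (exist _ t0 (asboolT St0)).
exists b => x; rewrite -principal_idealP -bE; split=> [h t _|h t St].
  by apply/principal_idealP/h/asboolP/(valP t).
exact/principal_idealP/(h (exist _ t (asboolT St)) I).
Qed.

Section Maximal.
Hypothesis maxR : maximal_almost_principal.

Let annR : principal_annihilators R.
Proof. by case: maxR => _ ? ?; exact: ideals_annihilators val_R max_P _ _. Qed.

Let dann := annihilators_double annR.

Lemma maximal_injective : self_injective R.
Proof.
by case: maxR => mR _ _; apply: baer_injective; exact: baer_extension.
Qed.

Lemma maximal_trace_product (I : Type) (M : I -> lmodType R) :
  (forall i, trace_module (M i)) -> trace_module (module_product M).
Proof. exact: (trace_product val_R max_P annR dann maximal_injective). Qed.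

Lemma maximal_trace_power (I : Type) : trace_module (module_power R I).
Proof. by apply: maximal_trace_product => i; exact: regular_trace. Qed.

Lemma maximal_countably_gen (A : ideal R) : countably_gen A.
Proof.
have principalC a : countably_gen (principal_ideal a : set R^o).
  by exists [set (a : R^o)]; [exact: countable1|rewrite generated1_ideal].
case: maxR => _ _ /(_ A) [a [->|AE]]; first exact: principalC.
case: (pselect (is_principal_ideal P)) => [/(principal_mulP a) [b bE]|nP].
  by rewrite AE bE; exact: principalC.
have [q Pq genq] := P_countably_generated val_R max_P
  (zero_divisors_max val_R max_P annR Z_neq0) (annihilators_intersections annR) nP.
exists (range (fun n => q n * a : R^o)).
  exact: sub_countable (card_image_le _ _) _.
rewrite AE; apply/seteqP; split=> x.
  move=> [p Pp <-]; have [n [r ->]] := genq p Pp.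
  rewrite -mulrA; apply: (generatedZ (M := R^o)).
  by apply: sub_gen_smallest; exists n.
apply: generated_ind => [|_ [n _ <-]]; last by exists (q n).
by rewrite -AE; exact: submoduleP.
Qed.

Lemma maximal_annihilators_fin_gen (A : ideal R) : fin_gen (annihilator_of A).
Proof.
have [b bP] := annR (A : set R); suff -> : annihilator_of A = principal_ideal b.
  exact: fin_gen_principal.
by apply/seteqP; split=> x; [move=> /(bP x).1/principal_idealP|
  move=> /principal_idealP/(bP x).2].
Qed.

Lemma maximal_intersections (I : Type) (a : I -> R) : [set: I] !=set0 ->
  fin_gen (\bigcap_i principal_ideal (a i) : set R^o).
Proof.
move=> [i0 _]; have [|b bP] := annihilators_intersections annR (S := range a).
  by exists (a i0), i0.
suff -> : \bigcap_i principal_ideal (a i) = principal_ideal b by exact: fin_gen_principal.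
apply/seteqP; split=> x.
  move=> h; apply/principal_idealP/bP => _ [i _ <-].
  exact/principal_idealP/h.
by move=> /principal_idealP/bP h i _; apply/principal_idealP/h; exists i.
Qed.

Lemma maximal_sep_flat_content_product (I : Type) (M : I -> lmodType R) :
  (forall i, sep_flat_content (M i)) -> sep_flat_content (module_product M).
Proof.
move=> sfcM; apply: (trace_sep_flat_content val_R max_P).
apply: maximal_trace_product => i; have [_] := sfcM i.
exact: (flat_content_trace val_R max_P maximal_injective).
Qed.

Lemma maximal_power (I : Type) :
  singly_projective (module_power R I) /\ separable_module (module_power R I).
Proof.
have trI := @maximal_trace_power I; split; last exact: (trace_separable val_R max_P trI).
exact/locally_projective_singly/(trace_locally_projective val_R max_P trI).
Qed.

End Maximal.
End Equivalences.

Theorem theorem5p5 (R : comNzRingType) (P : ideal R)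
    (val_R : valuation_ring R) (max_P : maximal_ideal P)
    (Z_neq0 : zero_divisors R <> [set 0]) :
  [<-> (*1*) strongly_coherent R;
       (*2*) pi_coherent R;
       (*3*) singly_projective (module_power R R) /\ separable_module (module_power R R);
       (*4*) forall C : lmodType R, fin_gen [set: C] -> fin_gen (dual_module C);
       (*5*) (forall A : ideal R, is_proper_ideal A -> fin_gen (annihilator_of A)) /\
             self_injective R;
       (*6*) [/\ maximal_ring R,
                 is_principal_ideal P \/ faithful_ideal P &
                 forall A : ideal R, exists a : R,
                   A = principal_ideal a :> set R \/ A = ideal_mulr P a :> set R];
       (*7*) (forall A : ideal R, countably_gen A) /\
             singly_projective (module_power R nat) /\ separable_module (module_power R nat);
       (*8*) sep_flat_content (module_power R R);
       (*9*) (forall A : ideal R, countably_gen A) /\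
             sep_flat_content (module_power R nat);
       (*10*) forall (I : Type) (M : I -> lmodType R),
                (forall i, sep_flat_content (M i)) ->
                sep_flat_content (module_product M);
       (*11*) [/\ maximal_ring R,
                  is_principal_ideal P \/ faithful_ideal P &
                  forall (I : Type) (a : I -> R), [set: I] !=set0 ->
                    fin_gen (\bigcap_i principal_ideal (a i))]].
Proof.
have trR := trace_sep_flat_content val_R max_P (@regular_trace R).
have self_idx := @ideals_indexed_by_self R.
have idx := @ideals_indexed_by_nat R val_R.
have core3 := @singly_projective_maximal R P val_R max_P Z_neq0 R self_idx.
have core5 := @injective_maximal R P val_R max_P Z_neq0.
have core8 := @flat_content_maximal R P val_R max_P Z_neq0 R self_idx.
have core10 : (forall (I : Type) (M : I -> lmodType R),
      (forall i, sep_flat_content (M i)) -> sep_flat_content (module_product M)) ->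
    maximal_almost_principal P.
  by move=> prodR; apply: core8; apply: prodR => _; exact: trR.
(* The implications form one cycle, and each of them goes through (6). *)
tfae.
- move=> cohR.
  have trRR : trace_module (module_power R R).
    apply: (locally_projective_trace val_R); apply: cohR => _.
    exact: (trace_locally_projective val_R max_P (@regular_trace R)).
  have lpRR := trace_locally_projective val_R max_P trRR.
  have maxR : maximal_almost_principal P.
    apply: core3; first exact: locally_projective_singly.
    exact: (trace_separable val_R max_P trRR).
  have [mR pfP idR] := maxR; apply: (trace_pi_coherent val_R max_P).
    exact: (ideals_annihilators val_R max_P pfP idR).
  by move=> I; exact: (maximal_trace_power val_R max_P Z_neq0 maxR).
- move=> /(pi_coherent_relations val_R).
  move=> /(relations_maximal val_R max_P Z_neq0) maxR.
  exact: (maximal_power val_R max_P Z_neq0 maxR R).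
- move=> [spR sepR]; have maxR := core3 spR sepR.
  have [mR pfP idR] := maxR; apply: (trace_dual_fin_gen val_R max_P).
    exact: (ideals_annihilators val_R max_P pfP idR).
  by move=> I; exact: (maximal_trace_power val_R max_P Z_neq0 maxR).
- move=> /(fin_gen_dual_relations val_R).
  move=> /(relations_maximal val_R max_P Z_neq0) maxR; split.
    by move=> A _; exact: (maximal_annihilators_fin_gen val_R max_P maxR A).
  exact: (maximal_injective val_R max_P Z_neq0 maxR).
- by move=> [annR injR]; exact: core5.
- move=> maxR; split; first exact: (maximal_countably_gen val_R max_P Z_neq0 maxR).
  exact: (maximal_power val_R max_P Z_neq0 maxR nat).
- move=> [/idx idN [spN sepN]].
  have maxR := singly_projective_maximal val_R max_P Z_neq0 idN spN sepN.
  apply: (maximal_sep_flat_content_product val_R max_P Z_neq0 maxR) => _.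
  exact: trR.
- move=> /core8 maxR; split; first exact: (maximal_countably_gen val_R max_P Z_neq0 maxR).
  apply: (maximal_sep_flat_content_product val_R max_P Z_neq0 maxR) => _.
  exact: trR.
- move=> [/idx idN sfcN].
  have maxR := flat_content_maximal val_R max_P Z_neq0 idN sfcN.
  exact: (maximal_sep_flat_content_product val_R max_P Z_neq0 maxR).
- move=> /core10 maxR; have [mR pfP _] := maxR; split=> // I a.
  exact: (maximal_intersections val_R max_P Z_neq0 maxR).
- move=> [mR pfP capR]; have maxR := intersections_maximal val_R max_P mR pfP capR.
  move=> I M lpM; apply: (trace_locally_projective val_R max_P).
  apply: (maximal_trace_product val_R max_P Z_neq0 maxR) => i.
  exact: (locally_projective_trace val_R (lpM i)).
Qed.
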